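(* Let $d$ and $n$ be positive integers with $n\geq 3$ and $d\geq n$. Then the partition Temperley-Lieb algebra ${\rm PTL}_n(q)$ is isomorphic, as a $\mathbb{C}(q)$-algebra, to the algebra $${\rm FTL}_{d,n}^{(\rm br)}(q)={\rm Y}_{d,n}^{(\rm br)}(q)\,/\,\langle e_1e_2g_{1,2}\rangle ,$$ where ${\rm Y}_{d,n}^{(\rm br)}(q)$ is the subalgebra of the Yokonuma-Hecke algebra ${\rm Y}_{d,n}(q)$ generated by the braiding generators $g_1,\ldots,g_{n-1}$, $g_{1,2}=1+q(g_1+g_2)+q^2(g_1g_2+g_2g_1)+q^3g_1g_2g_1$, and $\langle e_1e_2g_{1,2}\rangle$ is the two-sided ideal of ${\rm Y}_{d,n}^{(\rm br)}(q)$ generated by $e_1e_2g_{1,2}$.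
   Context: All algebras are associative unital algebras over the field $\mathbb{C}(q)$, where $q$ is an indeterminate. For $1\le i\le n-1$, $s_i$ denotes the elementary transposition $(i,i+1)$ in the symmetric group $S_n$. **Yokonuma-Hecke algebra.** ${\rm Y}_{d,n}(q)$ is the $\mathbb{C}(q)$-algebra generated by $g_1,\ldots,g_{n-1}$ (the braiding generators) and $t_1,\ldots,t_n$ (the framing generators) subject to the relations: - $g_ig_j=g_jg_i$ for $|i-j|>1$; - $g_ig_jg_i=g_jg_ig_j$ for $|i-j|=1$; - $t_i^d=1$ for all $i$, and $t_it_j=t_jt_i$ for all $i,j$; - $g_it_j=t_{s_i(j)}g_i$ for all $i,j$; - $g_i^2=1+(q-q^{-1})e_ig_i$ for all $i$, where $e_i:=\frac{1}{d}\sum_{s=0}^{d-1}t_i^st_{i+1}^{d-s}$ for $1\le i\le n-1$. **The subalgebra ${\rm Y}_{d,n}^{(\rm br)}(q)$.** It is the (unital) subalgebra of ${\rm Y}_{d,n}(q)$ generated by $g_1,\ldots,g_{n-1}$. Equivalently, it is the image of the group algebra of the braid group $B_n$ over $\mathbb{C}(q)$ under $\sigma_i\mapsto g_i$. Each $e_i$ lies in ${\rm Y}_{d,n}^{(\rm br)}(q)$, because $e_i=\frac{1}{q-q^{-1}}(g_i^3-g_i)-(g_i^2-1)$. Hence $e_1e_2g_{1,2}\in{\rm Y}_{d,n}^{(\rm br)}(q)$. **Algebra of braids and ties.** $\mathcal{E}_n(q)$ is the $\mathbb{C}(q)$-algebra generated by $b_1,\ldots,b_{n-1},\epsilon_1,\ldots,\epsilon_{n-1}$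 subject to the relations: - $b_ib_{i+1}b_i=b_{i+1}b_ib_{i+1}$ for $1\le i\le n-2$; - $b_ib_j=b_jb_i$ for $|i-j|>1$; - $\epsilon_i\epsilon_j=\epsilon_j\epsilon_i$ for $|i-j|>1$; - $\epsilon_i^2=\epsilon_i$; - $\epsilon_ib_i=b_i\epsilon_i$; - $\epsilon_ib_j=b_j\epsilon_i$ for $|i-j|>1$; - $\epsilon_i\epsilon_jb_i=b_i\epsilon_i\epsilon_j=\epsilon_jb_i\epsilon_j$ for $|i-j|=1$; - $\epsilon_ib_jb_i=b_jb_i\epsilon_j$ for $|i-j|=1$; - $b_i^2=1+(q-q^{-1})\epsilon_ib_i$. **Partition Temperley-Lieb algebra.** For $n\ge 3$, ${\rm PTL}_n(q)$ is the quotient of $\mathcal{E}_n(q)$ by the two-sided ideal generated by the elements $$\epsilon_i\epsilon_{i+1}\left[1+q(b_i+b_{i+1})+q^2(b_ib_{i+1}+b_{i+1}b_i)+q^3b_ib_{i+1}b_i\right],\quad 1\le i\le n-2.$$ This ideal is principal, generated by the element with $i=1$. *)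

(* Defs.v *)
From HB Require Import structures.
From mathcomp Require Import all_boot all_order all_algebra.
From mathcomp Require Import perm fraction generic_quotient.
From mathcomp Require Import ring.
From mathcomp Require Import boolp classical_sets reals complex.
From mathcomp.multinomials Require Import monalg.

Set Implicit Arguments.
Unset Strict Implicit.
Unset Printing Implicit Defensive.

Import GRing.Theory Num.Theory.

Local Open Scope classical_set_scope.
Local Open Scope ring_scope.
Local Open Scope quotient_scope.

Section TwoSidedIdeal.
Variables (K : fieldType) (A : algType K).
Implicit Types (S I : set A) (a x y : A).

Definition ideal_closed I :=
  [/\ I 0,
      forall x y, I x -> I y -> I (x + y),
      forall a x, I x -> I (a * x) &
      forall a x, I x -> I (x * a)].

Definition ideal_gen S : set A := smallest ideal_closed S.

Lemma ideal_gen_closed S : ideal_closed (ideal_gen S).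
Proof.
split=> [I [[]]//|x y Ix Iy I IS|a x Ix I IS|a x Ix I IS].
- by have [[_ h _ _] _] := IS; apply: h; [apply: Ix|apply: Iy].
- by have [[_ _ h _] _] := IS; apply: h; apply: Ix.
- by have [[_ _ _ h] _] := IS; apply: h; apply: Ix.
Qed.

Lemma ideal_gen0 S : ideal_gen S 0.
Proof. by case: (ideal_gen_closed S). Qed.

Lemma ideal_genD S x y : ideal_gen S x -> ideal_gen S y -> ideal_gen S (x + y).
Proof. by case: (ideal_gen_closed S) => _ h _ _; apply: h. Qed.

Lemma ideal_genMl S a x : ideal_gen S x -> ideal_gen S (a * x).
Proof. by case: (ideal_gen_closed S) => _ _ h _; apply: h. Qed.

Lemma ideal_genMr S a x : ideal_gen S x -> ideal_gen S (x * a).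
Proof. by case: (ideal_gen_closed S) => _ _ _ h; apply: h. Qed.

Lemma ideal_genN S x : ideal_gen S x -> ideal_gen S (- x).
Proof. by move=> Sx; rewrite -mulN1r; apply: ideal_genMl. Qed.

Lemma ideal_genB S x y : ideal_gen S x -> ideal_gen S y -> ideal_gen S (x - y).
Proof. by move=> Sx Sy; apply: ideal_genD => //; apply: ideal_genN. Qed.

Lemma ideal_genZ S (c : K) x : ideal_gen S x -> ideal_gen S (c *: x).
Proof. by move=> Sx; rewrite -[x]mul1r scalerAl; apply: ideal_genMl. Qed.

Lemma ideal_gen_sub_ker (B : algType K) (f : {lrmorphism A -> B}) S :
  (forall x, S x -> f x = 0) -> forall x, ideal_gen S x -> f x = 0.
Proof.
move=> fS x; apply: (smallest_sub (X := [set x | f x = 0])) => //; split => /=.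
- exact: raddf0.
- by move=> y z fy fz; rewrite raddfD /= fy fz addr0.
- by move=> a y fy; rewrite rmorphM /= fy mulr0.
- by move=> a y fy; rewrite rmorphM /= fy mul0r.
Qed.

Lemma ideal_gen_proper (B : algType K) (f : {lrmorphism A -> B}) S :
  (forall x, S x -> f x = 0) -> ~ ideal_gen S 1.
Proof.
by move=> fS /(ideal_gen_sub_ker fS)/eqP; rewrite rmorph1 oner_eq0.
Qed.

End TwoSidedIdeal.

Section Quotient.
Variables (K : fieldType) (A : algType K) (S : set A).
Implicit Types (x y : A).

Definition ideal_equiv x y : bool := `[< ideal_gen S (x - y) >].

Lemma ideal_equiv_is_equiv : equiv_class_of ideal_equiv.
Proof.
split=> [x|x y|y x z].
- by apply/asboolP; rewrite subrr; apply: ideal_gen0.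
- by apply/asboolP/asboolP => h; rewrite -opprB; apply: ideal_genN.
- move=> /asboolP h1 /asboolP h2; apply/asboolP.
  by rewrite -[x](addrNK y) -addrA; apply: ideal_genD.
Qed.

Canonical ideal_equiv_equiv := EquivRelPack ideal_equiv_is_equiv.
Canonical ideal_equiv_encModRel := defaultEncModRel ideal_equiv.

(* [algType] only covers nonzero rings, hence the properness argument. *)
Hypothesis S1 : ~ ideal_gen S 1.

Definition alg_quot (_ : ~ ideal_gen S 1) := {eq_quot ideal_equiv}.
Local Notation Q := (alg_quot S1).

HB.instance Definition _ : EqQuotient A ideal_equiv Q := EqQuotient.on Q.
HB.instance Definition _ := Choice.on Q.

Lemma alg_quot_eqP x y : \pi_Q x = \pi_Q y <-> ideal_gen S (x - y).
Proof. by split=> [/eqquotP/asboolP|h]//; apply/eqquotP/asboolP. Qed.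

Lemma alg_quot_repr x : ideal_gen S (repr (\pi_Q x) - x).
Proof. by apply/alg_quot_eqP; rewrite reprK. Qed.

Let zero : Q := \pi_Q 0.
Let one : Q := \pi_Q 1.
Let opp (u : Q) : Q := \pi_Q (- repr u).
Let add (u v : Q) : Q := \pi_Q (repr u + repr v).
Let mul (u v : Q) : Q := \pi_Q (repr u * repr v).
Let scale (c : K) (u : Q) : Q := \pi_Q (c *: repr u).

Let pi_opp x : opp (\pi_Q x) = \pi_Q (- x).
Proof.
apply/alg_quot_eqP; rewrite opprK addrC -opprB.
by apply: ideal_genN; apply: alg_quot_repr.
Qed.

Let pi_add x y : add (\pi_Q x) (\pi_Q y) = \pi_Q (x + y).
Proof.
by apply/alg_quot_eqP; rewrite opprD addrACA; apply: ideal_genD;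
  apply: alg_quot_repr.
Qed.

Let pi_mul x y : mul (\pi_Q x) (\pi_Q y) = \pi_Q (x * y).
Proof.
apply/alg_quot_eqP; rewrite -(subrKA (x * repr (\pi_Q y))) -mulrBl -mulrBr.
by apply: ideal_genD; [apply: ideal_genMr|apply: ideal_genMl];
  apply: alg_quot_repr.
Qed.

Let pi_scale c x : scale c (\pi_Q x) = \pi_Q (c *: x).
Proof.
by apply/alg_quot_eqP; rewrite -scalerBr; apply: ideal_genZ;
  apply: alg_quot_repr.
Qed.

Let piE := (pi_opp, pi_add, pi_mul, pi_scale).

Let qind (P : Q -> Prop) : (forall x, P (\pi_Q x)) -> forall u, P u.
Proof. by move=> h u; rewrite -[u]reprK. Qed.

Let addA : associative add.
Proof. by do 3!elim/qind=> ?; rewrite !piE addrA. Qed.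
Let addC : commutative add.
Proof. by do 2!elim/qind=> ?; rewrite !piE addrC. Qed.
Let add0 : left_id zero add.
Proof. by elim/qind=> ?; rewrite !piE add0r. Qed.
Let addN : left_inverse zero opp add.
Proof. by elim/qind=> ?; rewrite !piE addNr. Qed.

HB.instance Definition _ := GRing.isZmodule.Build Q addA addC add0 addN.

Let mulA : associative mul.
Proof. by do 3!elim/qind=> ?; rewrite !piE mulrA. Qed.
Let mul1 : left_id one mul.
Proof. by elim/qind=> ?; rewrite !piE mul1r. Qed.
Let mulq1 : right_id one mul.
Proof. by elim/qind=> ?; rewrite !piE mulr1. Qed.
Let mulDl : left_distributive mul add.
Proof. by do 3!elim/qind=> ?; rewrite !piE mulrDl. Qed.
Let mulDr : right_distributive mul add.
Proof. by do 3!elim/qind=> ?; rewrite !piE mulrDr. Qed.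
Let one_neq0 : one != zero.
Proof. by apply/eqP => /alg_quot_eqP; rewrite subr0. Qed.

HB.instance Definition _ := GRing.Zmodule_isNzRing.Build Q
  mulA mul1 mulq1 mulDl mulDr one_neq0.

Let scaleA a b u : scale a (scale b u) = scale (a * b) u.
Proof. by elim/qind: u => ?; rewrite !piE scalerA. Qed.
Let scale1 : left_id 1 scale.
Proof. by elim/qind=> ?; rewrite !piE scale1r. Qed.
Let scaleDr : right_distributive scale add.
Proof. by move=> c; do 2!elim/qind=> ?; rewrite !piE scalerDr. Qed.
Let scaleDl u : {morph scale^~ u : a b / a + b >-> add a b}.
Proof. by elim/qind: u => ? a b; rewrite !piE scalerDl. Qed.

HB.instance Definition _ := GRing.Zmodule_isLmodule.Build K Q
  scaleA scale1 scaleDr scaleDl.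

Let scaleAl c (u v : Q) : c *: (u * v) = c *: u * v.
Proof.
by elim/qind: u => x; elim/qind: v => y; rewrite -[LHS]/(scale c (mul _ _))
  -[RHS]/(mul (scale c _) _) !piE scalerAl.
Qed.
HB.instance Definition _ := GRing.Lmodule_isLalgebra.Build K Q scaleAl.

Let scaleAr c (u v : Q) : c *: (u * v) = u * (c *: v).
Proof.
by elim/qind: u => x; elim/qind: v => y; rewrite -[LHS]/(scale c (mul _ _))
  -[RHS]/(mul _ (scale c _)) !piE scalerAr.
Qed.
HB.instance Definition _ := GRing.Lalgebra_isAlgebra.Build K Q scaleAr.

Definition quot_pi (x : A) : Q := \pi_Q x.

Let quot_pi_zmod : zmod_morphism quot_pi.
Proof.
by move=> x y; rewrite /quot_pi -pi_add -pi_opp.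
Qed.
HB.instance Definition _ := GRing.isZmodMorphism.Build A Q quot_pi quot_pi_zmod.

Let quot_pi_monoid : monoid_morphism quot_pi.
Proof. by split=> // x y; rewrite /quot_pi -pi_mul. Qed.
HB.instance Definition _ :=
  GRing.isMonoidMorphism.Build A Q quot_pi quot_pi_monoid.

Let quot_pi_scalable : scalable quot_pi.
Proof. by move=> c x; rewrite /quot_pi -pi_scale. Qed.
HB.instance Definition _ :=
  GRing.isScalable.Build K A Q *:%R quot_pi quot_pi_scalable.

Lemma quot_pi_surj (u : Q) : exists x, u = quot_pi x.
Proof. by exists (repr u); rewrite /quot_pi reprK. Qed.

Lemma quot_pi_eq x y : quot_pi x = quot_pi y <-> ideal_gen S (x - y).
Proof. exact: alg_quot_eqP. Qed.

Section Lift.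
Variables (B : algType K) (f : {lrmorphism A -> B}).
Hypothesis fS : forall x, S x -> f x = 0.

Definition quot_lift of (forall x, S x -> f x = 0) : Q -> B :=
  fun u => f (repr u).

Lemma quot_liftE x : quot_lift fS (quot_pi x) = f x.
Proof.
apply/eqP; rewrite -subr_eq0 -raddfB; apply/eqP.
by apply: (ideal_gen_sub_ker fS); apply: alg_quot_repr.
Qed.

Let lift_zmod : zmod_morphism (quot_lift fS).
Proof.
move=> u v; have [x ->] := quot_pi_surj u; have [y ->] := quot_pi_surj v.
by rewrite -raddfB !quot_liftE raddfB.
Qed.
HB.instance Definition _ :=
  GRing.isZmodMorphism.Build Q B (quot_lift fS) lift_zmod.

Let lift_monoid : monoid_morphism (quot_lift fS).
Proof.
split=> [|u v]; first by rewrite -(rmorph1 quot_pi) quot_liftE rmorph1.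
have [x ->] := quot_pi_surj u; have [y ->] := quot_pi_surj v.
by rewrite -rmorphM !quot_liftE rmorphM.
Qed.
HB.instance Definition _ :=
  GRing.isMonoidMorphism.Build Q B (quot_lift fS) lift_monoid.

Let lift_scalable : scalable (quot_lift fS).
Proof.
move=> c u; have [x ->] := quot_pi_surj u.
by rewrite -linearZ !quot_liftE linearZ.
Qed.
HB.instance Definition _ :=
  GRing.isScalable.Build K Q B *:%R (quot_lift fS) lift_scalable.

End Lift.
End Quotient.

Section GeneratedSubalgebra.
Variables (K : fieldType) (A : algType K) (S : set A).

Definition subalg_gen : set A :=
  smallest (fun B : set A => GRing.subalg_closed [in B]) S.

Definition in_subalg_gen : {pred A} := fun x => `[< subalg_gen x >].

Lemma in_subalg_genP x : reflect (subalg_gen x) (x \in in_subalg_gen).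
Proof. exact: asboolP. Qed.

Lemma subalg_gen_closed : GRing.subalg_closed in_subalg_gen.
Proof.
split=> [|c x y|x y].
- by apply/in_subalg_genP => B [[B1 _ _] _]; apply/set_mem.
- move=> /in_subalg_genP Sx /in_subalg_genP Sy; apply/in_subalg_genP => B BS.
  have [[_ h _] _] := BS; apply/set_mem/h; apply/mem_set.
    exact: Sx.
  exact: Sy.
- move=> /in_subalg_genP Sx /in_subalg_genP Sy; apply/in_subalg_genP => B BS.
  have [[_ _ h] _] := BS; apply/set_mem/h; apply/mem_set.
    exact: Sx.
  exact: Sy.
Qed.
HB.instance Definition _ :=
  GRing.isSubalgClosed.Build K A in_subalg_gen subalg_gen_closed.

Record subalg := Subalg { subalg_val : A; _ : subalg_val \in in_subalg_gen }.

HB.instance Definition _ := [isSub for subalg_val].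
HB.instance Definition _ := [Choice of subalg by <:].
HB.instance Definition _ := [SubChoice_isSubAlgebra of subalg by <:].

Let subalg_val_zmod : zmod_morphism subalg_val.
Proof. by []. Qed.
HB.instance Definition _ :=
  GRing.isZmodMorphism.Build subalg A subalg_val subalg_val_zmod.

Let subalg_val_monoid : monoid_morphism subalg_val.
Proof. by []. Qed.
HB.instance Definition _ :=
  GRing.isMonoidMorphism.Build subalg A subalg_val subalg_val_monoid.

Let subalg_val_scalable : scalable subalg_val.
Proof. by []. Qed.
HB.instance Definition _ :=
  GRing.isScalable.Build K subalg A *:%R subalg_val subalg_val_scalable.

End GeneratedSubalgebra.

Record free_package (K : fieldType) (I : choiceType) := FreePackage {
  package_alg : algType K;
  package_gen : I -> package_alg;
  package_eval : forall B : algType K, (I -> B) -> {lrmorphism package_alg -> B};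
  package_evalE : forall (B : algType K) (h : I -> B) i,
    package_eval h (package_gen i) = h i;
  package_uniq : forall (B : algType K) (f1 f2 : {lrmorphism package_alg -> B}),
    (forall i, f1 (package_gen i) = f2 (package_gen i)) -> f1 =1 f2 }.

Module FreeMalg.
Section FreeMalg.
Variables (K : fieldType) (I : choiceType).

Definition carrier := {malg K[{fmonom I}]}.

HB.instance Definition _ := GRing.Lalgebra.on carrier.

Let carrier_scalerAr (c : K) (x y : carrier) : c *: (x * y) = x * (c *: y).
Proof.
suff Zr (z : carrier) : c *: z = z * c%:MP by rewrite !Zr mulrA.
rewrite malgM_def malgZ_def fgmulgU.
by apply/eq_bigr=> k _; rewrite mulm1 mulrC.
Qed.
HB.instance Definition _ :=
  GRing.Lalgebra_isAlgebra.Build K carrier carrier_scalerAr.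

Definition gen (i : I) : carrier := << fmu i >>.

Section Eval.
Variables (B : algType K) (h : I -> B).

Definition word_eval (w : {fmonom I}) : B := \prod_(i <- w) h i.

Lemma word_eval_mmorphism : mmorphism word_eval.
Proof.
split=> [w1 w2|]; rewrite /word_eval ?fmM ?big_cat //.
by rewrite fm1 big_nil.
Qed.
HB.instance Definition _ :=
  isMultiplicative.Build {fmonom I} B word_eval word_eval_mmorphism.

Definition eval (x : carrier) : B := mmap (in_alg B) word_eval x.

Let eval_zmod : zmod_morphism eval.
Proof. exact: mmap_is_additive. Qed.
HB.instance Definition _ :=
  GRing.isZmodMorphism.Build carrier B eval eval_zmod.

Let eval_monoid : monoid_morphism eval.
Proof.
have [] // : multiplicative (mmap (in_alg B) word_eval).
apply: commr_mmap_is_multiplicative => x m w.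
by rewrite /GRing.comm /= mulr_algl mulr_algr.
Qed.
HB.instance Definition _ :=
  GRing.isMonoidMorphism.Build carrier B eval eval_monoid.

Let eval_scalable : scalable eval.
Proof. by move=> c x; rewrite /eval mmapZ /= mulr_algl. Qed.
HB.instance Definition _ :=
  GRing.isScalable.Build K carrier B *:%R eval eval_scalable.

Lemma evalE i : eval (gen i) = h i.
Proof. by rewrite /eval mmapU /= /word_eval fmU big_seq1 scale1r mul1r. Qed.

End Eval.

Lemma eval_uniq (B : algType K) (f1 f2 : {lrmorphism carrier -> B}) :
  (forall i, f1 (gen i) = f2 (gen i)) -> f1 =1 f2.
Proof.
move=> f12; have f12U (w : {fmonom I}) : f1 << w >> = f2 << w >>.
  case: w => s; elim: s => [|i s IHs].
    have -> : (<< FMonom [::] >> : carrier) = 1 by rewrite -fmoneE.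
    by rewrite !rmorph1.
  have -> : (<< FMonom (i :: s) >> : carrier) = gen i * << FMonom s >>.
    by rewrite /gen malgM_def fgmulUU mulr1 /mmul /= fmmulE fmuE.
  by rewrite (rmorphM f1) (rmorphM f2) /= f12 IHs.
move=> x; rewrite [x]monalgE !raddf_sum; apply: eq_bigr => w _.
set c := mcoeff _ _; have -> : (<< c *g w >> : carrier) = c *: (<< w >> : carrier).
  by rewrite -mul_malgC malgM_def fgmulUU mulr1 mul1m.
by rewrite /= !linearZ /= f12U.
Qed.

Definition package : free_package K I :=
  @FreePackage K I carrier gen (fun B h => eval h) evalE eval_uniq.

End FreeMalg.
End FreeMalg.

(* Locked, because unification would otherwise spend minutes unfolding the
   product of [malg]. *)
HB.lock Definition free_malg (K : fieldType) (I : choiceType) :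
  free_package K I := FreeMalg.package K I.

Section FreeAlgebra.
Variables (K : fieldType) (I : choiceType).

Definition free_alg : algType K := package_alg (free_malg K I).

Definition free_gen : I -> free_alg := @package_gen K I _.

Definition free_eval (B : algType K) (h : I -> B) : {lrmorphism free_alg -> B} :=
  package_eval _ h.

Lemma free_evalE (B : algType K) (h : I -> B) i : free_eval h (free_gen i) = h i.
Proof. exact: package_evalE. Qed.

Lemma free_eval_uniq (B : algType K) (f1 f2 : {lrmorphism free_alg -> B}) :
  (forall i, f1 (free_gen i) = f2 (free_gen i)) -> f1 =1 f2.
Proof. exact: package_uniq. Qed.

End FreeAlgebra.
Arguments free_gen : clear implicits.
Arguments free_gen K {I} i.

(* The quotient of the free algebra on [I] by the relations [l = r], for
   [rel l r], is the quotient by the ideal generated by [relators rel]. *)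
Definition relators (K : fieldType) (I : choiceType)
    (rel : free_alg K I -> free_alg K I -> Prop) : set (free_alg K I) :=
  [set u | exists l r, rel l r /\ u = l - r].

Section Formulas.
Variables (K : fieldType) (q : K) (A : algType K).

Definition tie_elt (d : nat) (x y : A) : A :=
  (d%:R : K)^-1 *: \sum_(s < d) x ^+ s * y ^+ (d - s).

Definition steinberg_elt (x y : A) : A :=
  1 + q *: (x + y) + q ^+ 2 *: (x * y + y * x) + q ^+ 3 *: (x * y * x).

End Formulas.

Section MorphFormulas.
Variables (K : fieldType) (q : K) (A B : algType K) (f : {lrmorphism A -> B}).

Lemma rmorph_tie_elt d x y : f (tie_elt d x y) = tie_elt d (f x) (f y).
Proof.
rewrite /tie_elt linearZ raddf_sum; congr (_ *: _); apply: eq_bigr => s _.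
by rewrite /= rmorphM !rmorphXn.
Qed.

Lemma rmorph_steinberg_elt x y :
  f (steinberg_elt q x y) = steinberg_elt q (f x) (f y).
Proof. by rewrite /steinberg_elt !linearD !linearZ /= rmorph1 !rmorphM. Qed.

End MorphFormulas.

Definition regular_alg (K : fieldType) : algType K := K^o.

Section ScalarFormulas.
Variables (K : fieldType) (q : K).
Hypothesis q0 : q != 0.

Lemma tie_elt11 d : tie_elt d 1 1 = (d%:R != 0 :> K)%:R :> regular_alg K.
Proof.
rewrite /tie_elt (eq_bigr (fun=> 1)); last by move=> s _; rewrite !expr1n mulr1.
rewrite sumr_const card_ord -[LHS]/(_ * _); have [->|d0] := eqVneq (d%:R : K) 0.
  by rewrite mulr0.
exact: mulVf.
Qed.

Lemma steinberg_eltV : steinberg_elt q (- q^-1 : regular_alg K) (- q^-1) = 0.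
Proof.
pose x : K := - q^-1.
suff : 1 + q * (x + x) + q ^+ 2 * (x * x + x * x) + q ^+ 3 * (x * x * x) = 0.
  by [].
by rewrite /x; field.
Qed.

Lemma tie_elt_idem (A : algType K) d (x y : A) :
    GRing.comm x y -> x ^+ d = 1 -> y ^+ d = 1 -> d%:R != 0 :> K ->
  tie_elt d x y * tie_elt d x y = tie_elt d x y.
Proof.
move=> xy xd yd d0; pose w := x * y ^+ d.-1.
have d_gt0 : (0 < d)%N by case: d d0 {xd yd w} => //; rewrite eqxx.
have ys s : (s <= d)%N -> y ^+ (d.-1 * s) = y ^+ (d - s).
  move=> sd; rewrite -[LHS]mulr1 -yd -{2}(subnKC sd) exprD mulrA -exprD.
  by rewrite -mulSnr prednK // exprM yd expr1n mul1r.
have ws s : (s <= d)%N -> w ^+ s = x ^+ s * y ^+ (d - s).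
  move=> sd; have xyd : GRing.comm x (y ^+ d.-1) by apply: commrX.
  by rewrite /w (exprMn_comm _ xyd) -exprM (ys _ sd).
have wd : w ^+ d = 1 by rewrite ws // subnn xd mulr1.
pose sw := \sum_(s < d) w ^+ s.
have eE : tie_elt d x y = (d%:R : K)^-1 *: sw.
  by congr (_ *: _); apply: eq_bigr => s _; rewrite ws // ltnW.
have wsw : w * sw = sw.
  by apply/eqP; rewrite -subr_eq0 -{2}[sw]mul1r -mulrBl -subrX1 wd subrr.
have wXsw s : w ^+ s * sw = sw.
  by elim: s => [|s IHs]; rewrite ?mul1r // exprS -mulrA IHs.
have sw2 : sw * sw = d%:R *: sw.
  rewrite {1}/sw mulr_suml (eq_bigr (fun=> sw)) => [|s _]; last exact: wXsw.
  by rewrite sumr_const card_ord scaler_nat.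
by rewrite eE -scalerAl -scalerAr sw2 (scalerA _ d%:R) mulVf // scale1r.
Qed.

End ScalarFormulas.

(* Generators are numbered from 0: the braid index [i : 'I_n.-1] involves the
   strands [strand_lo i] and [strand_hi i], of values [i] and [i.+1]. *)
Section Indices.
Variable n : nat.
Implicit Types i j : 'I_n.-1.

Definition strand_lo i : 'I_n := widen_ord (leq_pred n) i.

Lemma strand_hi_subproof i : (i.+1 < n)%N.
Proof. by rewrite -ltn_predRL. Qed.
Definition strand_hi i : 'I_n := Ordinal (strand_hi_subproof i).

Definition adjacent i j := (j == i.+1 :> nat) || (i == j.+1 :> nat).
Definition distant i j := (i.+1 < j)%N || (j.+1 < i)%N.

End Indices.

Section YokonumaHecke.
Variables (K : fieldType) (q : K) (q0 : q != 0) (d n : nat).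

Definition Y_gen : choiceType := ('I_n.-1 + 'I_n)%type.
Local Notation Y_free := (free_alg K Y_gen).

Section Relations.
Let g (i : 'I_n.-1) : Y_free := free_gen K (inl i : Y_gen).
Let t (j : 'I_n) : Y_free := free_gen K (inr j : Y_gen).
Let e (i : 'I_n.-1) : Y_free := tie_elt d (t (strand_lo i)) (t (strand_hi i)).

Variant Y_rel : Y_free -> Y_free -> Prop :=
| Y_rel_comm i j of distant i j : Y_rel (g i * g j) (g j * g i)
| Y_rel_braid i j of adjacent i j : Y_rel (g i * g j * g i) (g j * g i * g j)
| Y_rel_framing_order j : Y_rel (t j ^+ d) 1
| Y_rel_framing_comm j k : Y_rel (t j * t k) (t k * t j)
| Y_rel_mixed i j :
    Y_rel (g i * t j) (t (tperm (strand_lo i) (strand_hi i) j) * g i)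
| Y_rel_quadratic i : Y_rel (g i ^+ 2) (1 + (q - q^-1) *: (e i * g i)).

End Relations.

(* A one-dimensional representation, witnessing that the algebras below are
   nonzero. *)
Let xi : regular_alg K := if d%:R == 0 :> K then -1 else - q^-1.
Let xi_gen (u : Y_gen) : regular_alg K := if u is inl _ then xi else 1.

Let xi_quadratic : xi ^+ 2 = 1 + (q - q^-1) *: (tie_elt d 1 1 * xi).
Proof.
rewrite tie_elt11 /xi -[_ *: _]/(_ * _); case: (d%:R == 0) => /=.
  by rewrite mul0r mulr0 addr0 sqrrN expr1n.
by rewrite mul1r; field.
Qed.

Let scalar_rel (f : {lrmorphism Y_free -> regular_alg K}) u :
  (forall u, f (free_gen K u) = xi_gen u) -> relators Y_rel u -> f u = 0.
Proof.
move=> fE [l [r [lr ->]]]; rewrite rmorphB /=; apply/eqP; rewrite subr_eq0.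
apply/eqP; case: lr => [i j _|i j _|j|j k|i j|i].
- by rewrite !rmorphM /= !fE.
- by rewrite !rmorphM /= !fE.
- by rewrite rmorphXn rmorph1 /= fE expr1n.
- by rewrite !rmorphM /= !fE.
- by rewrite !rmorphM /= !fE [LHS]mulrC.
- rewrite rmorphXn rmorphD /= rmorph1 linearZ /= rmorphM /= rmorph_tie_elt !fE.
  exact: xi_quadratic.
Qed.

Let chi0_rel u : relators Y_rel u -> free_eval xi_gen u = 0.
Proof. by apply: scalar_rel => v; apply: free_evalE. Qed.

Lemma YH_proper : ~ ideal_gen (relators Y_rel) 1.
Proof. exact: ideal_gen_proper chi0_rel. Qed.

Definition YH : algType K := alg_quot YH_proper.

Definition Y_g (i : 'I_n.-1) : YH := quot_pi YH_proper (free_gen K (inl i : Y_gen)).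
Definition Y_t (j : 'I_n) : YH := quot_pi YH_proper (free_gen K (inr j : Y_gen)).
Definition Y_e (i : 'I_n.-1) : YH :=
  tie_elt d (Y_t (strand_lo i)) (Y_t (strand_hi i)).

Lemma YH_relP l r : Y_rel l r -> quot_pi YH_proper l = quot_pi YH_proper r.
Proof.
by move=> lr; apply/quot_pi_eq; apply: sub_gen_smallest; exists l, r.
Qed.

Definition Ybr : algType K := subalg (range Y_g).

(* The element $e_1 e_2 g_{1,2}$, seen in [Ybr]: see [FTL_elt_singleton]. *)
Definition FTL_elt : set Ybr :=
  [set u | exists i j : 'I_n.-1, [/\ i = 0%N :> nat, j = 1%N :> nat &
     subalg_val u = Y_e i * Y_e j * steinberg_elt q (Y_g i) (Y_g j)]].

Let chi : {lrmorphism YH -> regular_alg K} := quot_lift (S1 := YH_proper) chi0_rel.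

Let chi_g i : chi (Y_g i) = xi.
Proof. by rewrite /chi [LHS]quot_liftE free_evalE. Qed.

Let chi_t j : chi (Y_t j) = 1.
Proof. by rewrite /chi [LHS]quot_liftE free_evalE. Qed.

Let scalar_FTL (f : {lrmorphism YH -> regular_alg K}) i j :
    (forall i, f (Y_g i) = xi) -> (forall j, f (Y_t j) = 1) ->
  f (Y_e i * Y_e j * steinberg_elt q (Y_g i) (Y_g j)) = 0.
Proof.
move=> f_g f_t; rewrite !rmorphM /= !rmorph_tie_elt rmorph_steinberg_elt.
rewrite !f_g !f_t tie_elt11 /xi; case: (d%:R == 0) => /=.
  by rewrite !mul0r.
by rewrite (steinberg_eltV q0) mulr0.
Qed.

Let chi_FTL u : FTL_elt u -> chi (subalg_val u) = 0.
Proof.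
move=> [i [j [_ _ uE]]]; rewrite uE.
exact: scalar_FTL chi_g chi_t.
Qed.

Lemma FTLbr_proper : ~ ideal_gen FTL_elt 1.
Proof.
pose f : {lrmorphism subalg (range Y_g) -> regular_alg K} :=
  chi \o @subalg_val K YH (range Y_g).
exact: (ideal_gen_proper (f := f) chi_FTL).
Qed.

Definition FTLbr : algType K := alg_quot FTLbr_proper.

Section Membership.
Hypotheses (d0 : d%:R != 0 :> K) (q2 : q - q^-1 != 0).

Lemma Y_e_idem i : Y_e i * Y_e i = Y_e i.
Proof.
have tX j : Y_t j ^+ d = 1.
  by rewrite -rmorphXn -(rmorph1 (quot_pi YH_proper)); apply/YH_relP;
    constructor.
apply: tie_elt_idem => //; rewrite /GRing.comm /Y_t -!rmorphM.
by apply/YH_relP; constructor.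
Qed.

Lemma Y_e_eq i :
  Y_e i = (q - q^-1)^-1 *: (Y_g i ^+ 3 - Y_g i) - (Y_g i ^+ 2 - 1).
Proof.
have g2 : Y_g i ^+ 2 = 1 + (q - q^-1) *: (Y_e i * Y_g i).
  rewrite /Y_e /Y_t -rmorph_tie_elt -rmorphM /= -linearZ /=.
  rewrite -(rmorph1 (quot_pi YH_proper)) -rmorphD -rmorphXn.
  by apply/YH_relP; constructor.
have -> : Y_g i ^+ 3 - Y_g i = (q - q^-1) *: (Y_e i + (Y_g i ^+ 2 - 1)).
  rewrite exprSr {1}g2 mulrDl mul1r addrC addKr -scalerAl -mulrA -expr2.
  congr (_ *: _); rewrite {1}g2 mulrDr mulr1 -scalerAr mulrA Y_e_idem.
  by rewrite g2 (addrC 1) addrK.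
by rewrite scalerA mulVf // scale1r addrK.
Qed.

Lemma Y_g_in_Ybr i : Y_g i \in in_subalg_gen (range Y_g).
Proof. by apply/in_subalg_genP; apply: sub_gen_smallest; exists i. Qed.

Lemma Y_e_in_Ybr i : Y_e i \in in_subalg_gen (range Y_g).
Proof.
by rewrite Y_e_eq !(rpredB, rpredZ, rpredX, rpred1, Y_g_in_Ybr).
Qed.

Lemma FTL_elt_in_Ybr i j :
  Y_e i * Y_e j * steinberg_elt q (Y_g i) (Y_g j) \in in_subalg_gen (range Y_g).
Proof.
apply: rpredM; first by apply: rpredM; apply: Y_e_in_Ybr.
by rewrite !(rpredM, rpredD, rpredZ, rpred1, Y_g_in_Ybr).
Qed.

Lemma FTL_elt_singleton : (3 <= n)%N -> exists u, FTL_elt = [set u].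
Proof.
move=> n3; have i0 : (0 < n.-1)%N by rewrite ltn_predRL (leq_trans _ n3).
have i1 : (1 < n.-1)%N by rewrite ltn_predRL.
exists (Subalg (FTL_elt_in_Ybr (Ordinal i0) (Ordinal i1))).
apply/seteqP; split=> [u [i [j [iE jE uE]]]|_ ->]; last first.
  by exists (Ordinal i0), (Ordinal i1).
have {}iE : i = Ordinal i0 by apply: val_inj.
have {}jE : j = Ordinal i1 by apply: val_inj.
by apply: val_inj; rewrite /= [LHS]uE iE jE.
Qed.

End Membership.

End YokonumaHecke.

Section BraidsAndTies.
Variables (K : fieldType) (q : K) (q0 : q != 0) (n : nat).

Definition BT_gen : choiceType := ('I_n.-1 + 'I_n.-1)%type.
Local Notation BT_free := (free_alg K BT_gen).

Section Relations.
Let b (i : 'I_n.-1) : BT_free := free_gen K (inl i : BT_gen).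
Let eps (i : 'I_n.-1) : BT_free := free_gen K (inr i : BT_gen).

Variant BT_rel : BT_free -> BT_free -> Prop :=
| BT_rel_braid (i j : 'I_n.-1) of j = i.+1 :> nat :
    BT_rel (b i * b j * b i) (b j * b i * b j)
| BT_rel_comm i j of distant i j : BT_rel (b i * b j) (b j * b i)
| BT_rel_eps_comm i j of distant i j : BT_rel (eps i * eps j) (eps j * eps i)
| BT_rel_eps_idem i : BT_rel (eps i ^+ 2) (eps i)
| BT_rel_eps_b i : BT_rel (eps i * b i) (b i * eps i)
| BT_rel_eps_b_comm i j of distant i j : BT_rel (eps i * b j) (b j * eps i)
| BT_rel_tie1 i j of adjacent i j :
    BT_rel (eps i * eps j * b i) (b i * eps i * eps j)
| BT_rel_tie2 i j of adjacent i j :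
    BT_rel (b i * eps i * eps j) (eps j * b i * eps j)
| BT_rel_slide i j of adjacent i j :
    BT_rel (eps i * b j * b i) (b j * b i * eps j)
| BT_rel_quadratic i : BT_rel (b i ^+ 2) (1 + (q - q^-1) *: (eps i * b i)).

End Relations.

Let zeta_gen (u : BT_gen) : regular_alg K := if u is inl _ then - q^-1 else 1.

Let scalar_rel (f : {lrmorphism BT_free -> regular_alg K}) u :
  (forall u, f (free_gen K u) = zeta_gen u) -> relators BT_rel u -> f u = 0.
Proof.
move=> fE [l [r [lr ->]]]; rewrite rmorphB /=; apply/eqP; rewrite subr_eq0.
apply/eqP; case: lr => [i j _|i j _|i j _|i|i|i j _|i j _|i j _|i j _|i].
all: rewrite ?rmorphXn ?rmorphM /= ?rmorphM /= ?fE ?mul1r ?mulr1 ?expr1n //.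
rewrite rmorphD /= rmorph1 linearZ /= rmorphM /= !fE mul1r.
suff : (- q^-1) ^+ 2 = 1 + (q - q^-1) * - q^-1 by [].
by field.
Qed.

Let zeta_rel u : relators BT_rel u -> free_eval zeta_gen u = 0.
Proof. by apply: scalar_rel => v; apply: free_evalE. Qed.

Lemma BT_proper : ~ ideal_gen (relators BT_rel) 1.
Proof. exact: ideal_gen_proper zeta_rel. Qed.

Definition BT : algType K := alg_quot BT_proper.

Definition BT_b (i : 'I_n.-1) : BT := quot_pi BT_proper (free_gen K (inl i : BT_gen)).
Definition BT_eps (i : 'I_n.-1) : BT :=
  quot_pi BT_proper (free_gen K (inr i : BT_gen)).

Definition PTL_elt : set BT :=
  [set u | exists i j : 'I_n.-1, j = i.+1 :> nat /\
     u = BT_eps i * BT_eps j * steinberg_elt q (BT_b i) (BT_b j)].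

Let zeta : {lrmorphism BT -> regular_alg K} := quot_lift (S1 := BT_proper) zeta_rel.

Let zeta_b i : zeta (BT_b i) = - q^-1.
Proof. by rewrite /zeta [LHS]quot_liftE free_evalE. Qed.

Let scalar_PTL (f : {lrmorphism BT -> regular_alg K}) i j :
    (forall i, f (BT_b i) = - q^-1) ->
  f (BT_eps i * BT_eps j * steinberg_elt q (BT_b i) (BT_b j)) = 0.
Proof.
move=> f_b; rewrite rmorphM /= rmorph_steinberg_elt !f_b.
by rewrite (steinberg_eltV q0) mulr0.
Qed.

Let zeta_PTL u : PTL_elt u -> zeta u = 0.
Proof. by move=> [i [j [_ ->]]]; apply: scalar_PTL zeta_b. Qed.

Lemma PTL_proper : ~ ideal_gen PTL_elt 1.
Proof. exact: ideal_gen_proper zeta_PTL. Qed.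

Definition PTL : algType K := alg_quot PTL_proper.

End BraidsAndTies.

Definition Cq (R : realType) : fieldType := {fraction {poly R[i]}}.
Definition qvar (R : realType) : Cq R := tofrac ('X : {poly R[i]}).

Lemma qvar_neq0 (R : realType) : qvar R != 0.
Proof. by rewrite tofrac_eq0 polyX_eq0. Qed.

Lemma qvarBV_neq0 (R : realType) : qvar R - (qvar R)^-1 != 0.
Proof.
rewrite subr_eq0; apply/eqP => qV.
have : qvar R * qvar R = 1 by rewrite {2}qV mulfV ?qvar_neq0.
rewrite -tofracM -tofrac1 => /eqP; rewrite tofrac_eq => /eqP.
move=> /(congr1 (fun p : {poly R[i]} => size p)).
by rewrite -expr2 size_polyXn size_poly1.
Qed.

Lemma Cq_nat_eq0 (R : realType) m : (m%:R == 0 :> Cq R) = (m == 0)%N.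
Proof.
rewrite -tofrac1 -tofracMn tofrac_eq0 -polyC1 -polyCMn polyC_eq0.
exact: pnatr_eq0.
Qed.

(* Main.v *)
(* Both algebras are quotients of E_n(q), because b_i |-> g_i, epsilon_i |-> e_i
   is an isomorphism of E_n(q) onto the braid subalgebra of Y_{d,n}(q) as soon
   as d >= n.  Surjectivity holds by definition.  For injectivity, let E_{xy} be
   the tie between arbitrary strands x and y, obtained from the epsilon_i by
   conjugation; conjugation by b_k permutes the E_{xy} through s_k, so they
   generate a commutative subalgebra C.  Every element of E_n(q) is then a
   combination of the coset words b_k b_{k-1} ... b_j with coefficients in C.
   The algebra Y_{d,n}(q) acts on pairs (colouring alpha of the strands by Z/d,
   permutation sigma): t_j scales by zeta^(alpha_j) for a primitive d-th root of
   unity zeta, and g_k swaps two strands, with a Hecke correction when they have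
   the same colour and sigma decreases.  On (alpha, 1) the coset words act by
   plain permutations, so an element acting by 0 has coefficients x in C with
   chi_alpha(x) = 0 for every colouring alpha; splitting 1 into products of the
   E_{xy} and 1 - E_{xy}, the nonzero ones being indexed by equivalence
   relations on the n <= d strands, that is by colourings, gives x = 0.  The
   ideals to divide by correspond, since conjugation by b_i b_{i+1} b_{i+2}
   shifts the i-th generator of the first one to the next. *)
Require Import Defs.
From HB Require Import structures.
From mathcomp Require Import all_boot all_order all_algebra reals.
From mathcomp Require Import perm cyclic fraction complex separable cyclotomic.
From mathcomp Require Import boolp classical_sets.
From mathcomp Require Import zify ring.
Set Implicit Arguments.
Unset Strict Implicit.
Unset Printing Implicit Defensive.
Import GRing.Theory Num.Theory.
Local Open Scope ring_scope.

(** * Ties between arbitrary strands *)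

(* Braids and ties on [N.+1] strands.  The generators are indexed by [nat]; only
   the relations between neighbours need their indices to be smaller than [N],
   so that [1] and [0] are admissible junk values beyond [N]. *)
Record braid_ties (K : fieldType) (A : algType K) (c : K) (N : nat)
    (b e : nat -> A) : Prop := BraidTies {
  bt_braid : forall i, (i.+1 < N)%N -> b i * b i.+1 * b i = b i.+1 * b i * b i.+1;
  bt_comm : forall i j, (i.+1 < j)%N -> b i * b j = b j * b i;
  bt_eps_comm : forall i j, (i.+1 < j)%N -> e i * e j = e j * e i;
  bt_eps_idem : forall i, e i * e i = e i;
  bt_eps_b : forall i, e i * b i = b i * e i;
  bt_eps_b_comm : forall i j, (i.+1 < j)%N || (j.+1 < i)%N -> e i * b j = b j * e i;
  bt_tie1 : forall i j, (i < N)%N -> (j < N)%N -> (j == i.+1) || (i == j.+1) ->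
    e i * e j * b i = b i * e i * e j;
  bt_tie2 : forall i j, (i < N)%N -> (j < N)%N -> (j == i.+1) || (i == j.+1) ->
    b i * e i * e j = e j * b i * e j;
  bt_slide : forall i j, (i < N)%N -> (j < N)%N -> (j == i.+1) || (i == j.+1) ->
    e i * b j * b i = b j * b i * e j;
  bt_quadratic : forall i, b i * b i = 1 + c *: (e i * b i) }.

(** Through it, identities between ties of distinct strands are reduced to the strands 0, 1, 2 and
    3. *)
Lemma exists_perm_map (T : finType) (s t : seq T) :
  uniq s -> uniq t -> size s = size t -> exists p : {perm T}, map p s = t.
Proof.
elim: s t => [|x s IHs] [|y t] //=; first by exists 1%g.
move=> /andP[xs us] /andP[yt ut] [/(IHs _ us ut)[p pE]].
exists (p * tperm (p x) y)%g; rewrite permM tpermL; congr (_ :: _).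
rewrite -[RHS]pE; apply/eq_in_map => z zs; rewrite permM tpermD //.
  by apply: contraNneq xs => /perm_inj ->.
by apply: contraNneq yt => ->; rewrite -pE map_f.
Qed.

Section BraidTies.
Variables (K : fieldType) (A : algType K) (c : K) (N : nat) (b e : nat -> A).
Hypothesis bt : braid_ties c N b e.

(** The inverse of [b k], read off the quadratic relation. *)
Let v k : A := b k - c *: e k.

Lemma b_binv k : b k * v k = 1.
Proof.
by rewrite /v mulrBr (bt_quadratic bt) -scalerAr (bt_eps_b bt) addrK.
Qed.

Lemma binv_b k : v k * b k = 1.
Proof. by rewrite /v mulrBl (bt_quadratic bt) -scalerAl addrK. Qed.

Lemma b_lreg k : GRing.lreg (b k).
Proof. by move=> x y /(congr1 (fun z => v k * z)); rewrite !mulrA binv_b !mul1r. Qed.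

Lemma b_rreg k : GRing.rreg (b k).
Proof. by move=> x y /(congr1 (fun z => z * v k)); rewrite -!mulrA b_binv !mulr1. Qed.

Lemma comm_binv k x : GRing.comm (b k) x -> GRing.comm (v k) x.
Proof.
move=> bx; apply: (@b_lreg k).
by rewrite mulrA b_binv mul1r mulrA bx -mulrA b_binv mulr1.
Qed.

Lemma comm_bb k l : (k.+1 < l)%N || (l.+1 < k)%N -> GRing.comm (b k) (b l).
Proof. by case/orP=> kl; [|apply/commr_sym]; apply: (bt_comm bt). Qed.

Lemma comm_be k l : (k.+1 < l)%N || (l.+1 < k)%N -> GRing.comm (b k) (e l).
Proof. by rewrite orbC => kl; apply/commr_sym; apply: (bt_eps_b_comm bt). Qed.

Lemma comm_b_binv k l : (k.+1 < l)%N || (l.+1 < k)%N -> GRing.comm (b k) (v l).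
Proof. by move=> kl; apply/commr_sym/comm_binv/commr_sym/comm_bb. Qed.

(* [b_i b_j b_i] exchanges [e_i] and [e_j] but commutes with [e_j e_i]. *)
Lemma eps_adjacent_comm i j : (i < N)%N -> (j < N)%N ->
  (j == i.+1) || (i == j.+1) -> e i * e j = e j * e i.
Proof.
move=> iN jN ij; have ji : (i == j.+1) || (j == i.+1) by rewrite orbC.
have fe_j : e j * e i * b j = b j * (e j * e i) by rewrite (bt_tie1 bt) // mulrA.
have fe_i : e j * e i * b i = b i * (e j * e i).
  apply: (@b_lreg j); rewrite !mulrA (bt_tie2 bt) // -(bt_slide bt) //.
  by rewrite -!mulrA (bt_eps_b bt).
pose w := b i * b j * b i.
have w_fe : e j * e i * w = w * (e j * e i).
  exact: (commrM (commrM fe_i fe_j) fe_i).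
have w_e : w * e i = e j * w.
  by rewrite /w -!mulrA -(bt_eps_b bt) !mulrA -(bt_slide bt).
have w_f : w * e j = e i * w.
  by rewrite /w -(mulrA (b i)) -mulrA -(bt_slide bt) // !mulrA (bt_eps_b bt).
apply/esym/(@b_rreg i)/(@b_rreg j)/(@b_rreg i).
by rewrite -!mulrA (mulrA (b i) (b j)) -/w mulrA w_fe mulrA w_f -mulrA w_e.
Qed.

(** By the quadratic relation only [e i * b i] matters, and it commutes with [e j] by the first tie
    relation. Hence conjugating [e j] by [b i] or by its inverse gives the same element. *)
Lemma comm_ebb i j : (i < N)%N -> (j < N)%N ->
  (j == i.+1) || (i == j.+1) -> GRing.comm (b i * b i) (e j).
Proof.
move=> iN jN ij; rewrite /GRing.comm (bt_quadratic bt) mulrDl mulrDr mul1r mulr1.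
congr (_ + _); rewrite -scalerAl -scalerAr; congr (_ *: _).
rewrite (bt_eps_b bt) -(bt_tie1 bt) // (eps_adjacent_comm iN jN ij).
by rewrite -mulrA (bt_eps_b bt).
Qed.

(* The tie between the strands [i] and [i + m.+1]. *)
Fixpoint tie i m : A :=
  if m is m'.+1 then b (i + m'.+1) * tie i m' * v (i + m'.+1) else e i.

Arguments tie : simpl never.

Lemma tieSE i m : tie i m.+1 = b (i + m.+1) * tie i m * v (i + m.+1).
Proof. by []. Qed.

Lemma b_tie_last i m : b (i + m.+1) * tie i m = tie i m.+1 * b (i + m.+1).
Proof. by rewrite tieSE -mulrA binv_b mulr1. Qed.

Lemma b_tie_far k i m : (k.+1 < i)%N || (i + m.+1 < k)%N ->
  GRing.comm (b k) (tie i m).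
Proof.
elim: m => [|m IHm] kim; first by apply: comm_be; lia.
rewrite tieSE; apply: commrM; last by apply: comm_b_binv; lia.
by apply: commrM; [apply: comm_bb|apply: IHm]; lia.
Qed.

Lemma conj_of_comm k x y : b k * x = y * b k -> y = b k * x * v k.
Proof. by move=> ->; rewrite -mulrA b_binv mulr1. Qed.

(** By definition a tie is extended at its right end; extending it at the left end gives the same
    element. For the shortest tie this is the slide relation, once [b i * b i] has been moved past
    [e i.+1]; then [b i] commutes with the generators added on the right. *)
Lemma b_tie_first i m : (i + m.+1 < N)%N ->
  b i * tie i.+1 m = tie i m.+1 * b i.
Proof.
elim: m => [|m IHm] imN.
  rewrite tieSE addn1; apply: (@b_lreg i); rewrite !mulrA comm_ebb; try lia.
  rewrite mulrA; congr (_ * _).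
  apply: (@b_rreg i.+1); rewrite -[RHS]mulrA binv_b mulr1.
  by rewrite -(bt_slide bt) //; lia.
rewrite (tieSE i m.+1) (tieSE i.+1 m) addSnnS !mulrA.
have -> : b i * b (i + m.+2) = b (i + m.+2) * b i by apply: comm_bb; lia.
rewrite -(mulrA _ (b i)) IHm; last by lia.
have b_binv_far : b i * v (i + m.+2) = v (i + m.+2) * b i by apply: comm_b_binv; lia.
by rewrite -!mulrA b_binv_far.
Qed.

Lemma bb_tie_first i m : (i + m.+1 < N)%N -> GRing.comm (b i * b i) (tie i.+1 m).
Proof.
elim: m => [|m IHm] imN; first by apply: comm_ebb; lia.
have bi : GRing.comm (b i * b i) (b (i.+1 + m.+1)).
  by apply/commr_sym/commrM; apply: comm_bb; lia.
rewrite tieSE; apply: commrM; last by apply/commr_sym/comm_binv/commr_sym.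
by apply: commrM => //; apply: IHm; lia.
Qed.

Lemma b_tie_pop_first i m : (i + m.+1 < N)%N ->
  b i * tie i m.+1 = tie i.+1 m * b i.
Proof.
move=> imN; apply: (@b_rreg i); rewrite -mulrA -b_tie_first //.
by rewrite mulrA bb_tie_first // mulrA.
Qed.

Lemma bb_tie_last i m : (i + m.+1 < N)%N ->
  GRing.comm (b (i + m.+1) * b (i + m.+1)) (tie i m).
Proof.
elim: m i => [|m IHm] i imN; first by apply: comm_ebb; lia.
have bi : GRing.comm (b i) (b (i + m.+2) * b (i + m.+2)).
  by apply: commrM; apply: comm_bb; lia.
(* Written from its left end, the tie is a shorter one conjugated by [b i], which commutes with the
   last generator. *)
have -> : tie i m.+1 = b i * tie i.+1 m * v i.
  by apply: conj_of_comm; rewrite b_tie_first //; lia.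
apply: commrM; last by apply/commr_sym/comm_binv.
by apply: commrM; [apply/commr_sym|rewrite -addSnnS; apply: IHm; lia].
Qed.

Lemma b_tie_pop_last i m : (i + m.+1 < N)%N ->
  b (i + m.+1) * tie i m.+1 = tie i m * b (i + m.+1).
Proof.
move=> imN; apply: (@b_rreg (i + m.+1)).
by rewrite -mulrA -b_tie_last mulrA bb_tie_last // mulrA.
Qed.

Lemma b_tie_inside k i m : (i < k < i + m)%N -> (i + m < N)%N ->
  GRing.comm (b k) (tie i m).
Proof.
elim: m => [|m IHm] ikm imN; first by lia.
have [km|km] := ltnP k (i + m).
  rewrite tieSE; apply: commrM; last by apply: comm_b_binv; lia.
  by apply: commrM; [apply: comm_bb|apply: IHm]; lia.
have {km} kE : k = (i + m)%N by lia.
case: m => [|m] in IHm ikm imN kE *; first by lia.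
(* What remains is [k] just inside the right end. There the tie is [tie i m] conjugated by
   [b k.+1 * b k]; by the braid relation, commuting with [b k] becomes the commutation of [tie i m]
   with [b k.+1]. *)
have tE : tie i m.+2 * b k.+1 * b k = b k.+1 * b k * tie i m.
  by rewrite kE -addnS -b_tie_last -mulrA -b_tie_last mulrA.
apply: (@b_rreg k.+1); apply: (@b_rreg k); rewrite -2!mulrA (mulrA (tie _ _)).
rewrite tE !mulrA (bt_braid bt); last by lia.
rewrite -2!(mulrA (tie _ _)) (bt_braid bt); last by lia.
rewrite !mulrA tE -!mulrA; do 2!congr (_ * _).
by apply: b_tie_far; lia.
Qed.

(** The value 1 at [x = y] ties each strand to itself, so that transitivity holds for all
    triples. *)
Definition strand_tie x y : A :=
  if (x < y)%N then tie x (y - x.+1) else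
  if (y < x)%N then tie y (x - y.+1) else 1.

Lemma strand_tieC x y : strand_tie x y = strand_tie y x.
Proof. by rewrite /strand_tie; case: ltngtP. Qed.

Lemma strand_tiexx x : strand_tie x x = 1.
Proof. by rewrite /strand_tie ltnn. Qed.

Lemma strand_tieS x : strand_tie x x.+1 = e x.
Proof. by rewrite /strand_tie ltnSn subnn. Qed.

Definition nswap k x := if x == k then k.+1 else if x == k.+1 then k else x.

(** For [x < y], the position of [k] relative to the two ends decides whether [b k] lengthens,
    shortens or commutes with the tie. *)
Lemma b_strand_tie k x y : (k < N)%N -> (x <= N)%N -> (y <= N)%N ->
  b k * strand_tie x y = strand_tie (nswap k x) (nswap k y) * b k.
Proof.
move=> kN; wlog xy : x y / (x <= y)%N => [th xN yN|].
  by have [|/ltnW] := leqP x y => xy; [|rewrite strand_tieC (strand_tieC (nswap k x))];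
    apply: th.
move=> xN yN; case: (ltngtP x y) xy => // [xy _|-> _]; last first.
  by rewrite !strand_tiexx mulr1 mul1r.
have [m yE] : exists m, y = (x + m.+1)%N by exists (y - x.+1)%N; lia.
have strand_tieE z p : strand_tie z (z + p.+1) = tie z p.
  by rewrite /strand_tie; have -> : (z < z + p.+1)%N by [lia]; congr tie; lia.
rewrite yE strand_tieE; have [xk|nxk] := eqVneq x k.
  case: m => [|m] in yE *.
    have -> : nswap k x = k.+1 by rewrite /nswap xk eqxx.
    have -> : nswap k (x + 1) = k by rewrite /nswap; do 2?case: eqP; lia.
    by rewrite strand_tieC strand_tieS xk (bt_eps_b bt).
  have -> : nswap k x = x.+1 by rewrite /nswap xk eqxx.
  have -> : nswap k (x + m.+2) = (x.+1 + m.+1)%N.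
    by rewrite /nswap; do 2?case: eqP; lia.
  by rewrite strand_tieE -xk; apply: b_tie_pop_first; lia.
have [yk|nyk] := eqVneq (x + m.+1)%N k.
  have -> : nswap k x = x by rewrite /nswap; do 2?case: eqP; lia.
  have -> : nswap k (x + m.+1) = (x + m.+2)%N.
    by rewrite /nswap; do 2?case: eqP; lia.
  by rewrite strand_tieE -yk; apply: b_tie_last.
have [xk|nxk1] := eqVneq x k.+1.
  have -> : nswap k x = k by rewrite /nswap; do 2?case: eqP; lia.
  have -> : nswap k (x + m.+1) = (k + m.+2)%N.
    by rewrite /nswap; do 2?case: eqP; lia.
  by rewrite strand_tieE xk; apply: b_tie_first; lia.
have -> : nswap k x = x by rewrite /nswap; do 2?case: eqP; lia.
have [yk|nyk1] := eqVneq (x + m.+1)%N k.+1.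
  have kE : k = (x + m)%N by lia.
  case: m => [|m] in yE nyk yk kE *; first by lia.
  have -> : nswap k (x + m.+2) = (x + m.+1)%N.
    by rewrite /nswap; do 2?case: eqP; lia.
  by rewrite strand_tieE kE; apply: b_tie_pop_last; lia.
have -> : nswap k (x + m.+1) = (x + m.+1)%N.
  by rewrite /nswap; do 2?case: eqP; lia.
rewrite strand_tieE; have [/b_tie_inside->//|xkm] := boolP (x < k < x + m)%N;
  first by lia.
by apply: b_tie_far; lia.
Qed.

Lemma b_strand_tie_tperm (k : 'I_N) (x y : 'I_N.+1) :
  let s := tperm (@strand_lo N.+1 k) (@strand_hi N.+1 k) in
  b k * strand_tie x y = strand_tie (s x) (s y) * b k.
Proof.
have sE (z : 'I_N.+1) :
    tperm (@strand_lo N.+1 k) (@strand_hi N.+1 k) z = nswap k z :> nat.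
  rewrite /nswap; case: tpermP => [->|->|/eqP nlo /eqP nhi] /=.
  - by rewrite eqxx.
  - by rewrite eqxx; case: eqP => //; lia.
  - by move: nlo nhi; rewrite -!val_eqE /= => /negPf-> /negPf->.
by move=> s; rewrite !sE; apply: b_strand_tie => //; rewrite -ltnS.
Qed.

(** [w] is a braid lift of [p], with inverse [w']. Only the existence of lifts matters, so no
    reduced words are chosen. *)
Let transports (p : 'S_N.+1) (w w' : A) := [/\ w * w' = 1, w' * w = 1 &
  forall x y : 'I_N.+1, w * strand_tie x y = strand_tie (p x) (p y) * w].

Let transports1 : transports 1 1 1.
Proof. by split=> [||x y]; rewrite ?mulr1 // !perm1 mul1r. Qed.

Let transportsM p1 p2 w1 w2 w1' w2' : transports p1 w1 w1' ->
  transports p2 w2 w2' -> transports (p1 * p2) (w2 * w1) (w1' * w2').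
Proof.
move=> [v1 v1' c1] [v2 v2' c2]; split=> [||x y].
- by rewrite mulrA -(mulrA w2) v1 mulr1.
- by rewrite mulrA -(mulrA w1') v2' mulr1.
- by rewrite -mulrA c1 mulrA c2 !permM mulrA.
Qed.

(** Induction on the distance: a transposition of distant strands is a shorter one conjugated by a
    neighbouring one. *)
Let transports_tperm (x y : 'I_N.+1) : exists w w', transports (tperm x y) w w'.
Proof.
wlog xy : x y / (x <= y)%N => [th|].
  by have [|/ltnW] := leqP x y => xy; [|rewrite tpermC]; apply: th.
have {xy} [m] : exists m, y = (x + m)%N :> nat by exists (y - x)%N; lia.
elim: m y => [|m IHm] y yE.
  have -> : y = x by apply: val_inj; rewrite /= yE addn0.
  by rewrite tperm1; exists 1, 1; apply: transports1.
have kN : (x + m < N)%N by rewrite -ltnS -addnS -yE.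
pose k : 'I_N := Ordinal kN.
have yhi : y = @strand_hi N.+1 k by apply: val_inj; rewrite /= yE addnS.
have tk : transports (tperm (@strand_lo N.+1 k) (@strand_hi N.+1 k)) (b k) (v k).
  by split=> [||z t]; [apply: b_binv|apply: binv_b|apply: b_strand_tie_tperm].
have [m0|m_gt0] := posnP m.
  have <- : @strand_lo N.+1 k = x by apply: val_inj; rewrite /= m0 addn0.
  by exists (b k), (v k); rewrite yhi.
have [w [w' tw]] := IHm (@strand_lo N.+1 k) erefl.
have -> : tperm x y = (tperm (@strand_lo N.+1 k) (@strand_hi N.+1 k) *
    tperm x (@strand_lo N.+1 k) *
    tperm (@strand_lo N.+1 k) (@strand_hi N.+1 k))%g.
  rewrite -[in RHS]mulgA -{1}[tperm _ _ in RHS]tpermV -/(conjg _ _) tpermJ tpermL yhi.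
  by congr tperm; rewrite tpermD // -val_eqE /=; lia.
by eexists; eexists; apply: (transportsM (transportsM tk tw) tk).
Qed.

Let transports_perm (p : 'S_N.+1) : exists w w', transports p w w'.
Proof.
have [ts -> _] := prod_tpermP p.
elim: ts => [|t ts [w [w' IHw]]]; first by rewrite big_nil; exists 1, 1; apply: transports1.
have [u [u' tu]] := transports_tperm t.1 t.2.
by rewrite big_cons; eexists; eexists; apply: (transportsM tu IHw).
Qed.

(** Conjugation by a lift of [p] renumbers the strands, so a quadratic identity between ties may be
    checked on convenient strands. *)
Let strand_tie_perm2 (p : 'S_N.+1) (x y z t x' y' z' t' : 'I_N.+1) :
  strand_tie x y * strand_tie z t = strand_tie x' y' * strand_tie z' t' ->
  strand_tie (p x) (p y) * strand_tie (p z) (p t) =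
  strand_tie (p x') (p y') * strand_tie (p z') (p t').
Proof.
move=> xyzt; have [w [w' [ww' _ wE]]] := transports_perm p.
have wEE (i j k l : 'I_N.+1) : w * (strand_tie i j * strand_tie k l) =
    strand_tie (p i) (p j) * strand_tie (p k) (p l) * w.
  by rewrite mulrA wE -mulrA wE mulrA.
by rewrite -[LHS]mulr1 -ww' mulrA -wEE xyzt wEE -mulrA ww' mulr1.
Qed.

Lemma strand_tie_idem x y : strand_tie x y * strand_tie x y = strand_tie x y.
Proof.
have tt i m : tie i m * tie i m = tie i m.
  elim: m => [|m IHm]; first exact: (bt_eps_idem bt).
  by rewrite tieSE !mulrA -(mulrA (b _ * tie i m)) binv_b mulr1 -(mulrA (b _)) IHm.
by rewrite /strand_tie; case: ltngtP => _; rewrite ?mulr1.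
Qed.

Let uniq_leq_N (s : seq 'I_N.+1) : uniq s -> (size s <= N.+1)%N.
Proof. by move/card_uniqP <-; rewrite -[X in (_ <= X)%N]card_ord max_card. Qed.

Let strand_tie3 (x y z : 'I_N.+1) : uniq [:: x; y; z] ->
  strand_tie x y * strand_tie y z = strand_tie y z * strand_tie x y /\
  strand_tie x y * strand_tie y z = strand_tie x y * strand_tie x z.
Proof.
move=> xyz; have N2 := uniq_leq_N xyz; rewrite /= in N2.
pose o k : 'I_N.+1 := inord k.
have o012 : uniq [:: o 0; o 1; o 2].
  by rewrite -(map_inj_uniq val_inj) /= /o !inordK //; lia.
have [p [<- <- <-]] := exists_perm_map o012 xyz erefl.
have eC : e 0 * e 1 = e 1 * e 0 by apply: eps_adjacent_comm => //; lia.
split; apply: strand_tie_perm2; rewrite /o !inordK; try lia.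
  by rewrite !strand_tieS.
(* The tie of the strands 0 and 2 is [e 0] conjugated by [b 1]; multiplying by [b 1] on the right
   leaves the two tie relations. *)
rewrite !strand_tieS /strand_tie /= tieSE addn1 /tie eC mulrA; apply: (@b_rreg 1).
rewrite -[RHS]mulrA binv_b mulr1 mulrA -(bt_tie2 bt) //; try lia.
by rewrite -(bt_tie1 bt) //; lia.
Qed.

Let strand_tie4 (x y z t : 'I_N.+1) : uniq [:: x; y; z; t] ->
  strand_tie x y * strand_tie z t = strand_tie z t * strand_tie x y.
Proof.
move=> xyz; have N2 := uniq_leq_N xyz; rewrite /= in N2.
pose o k : 'I_N.+1 := inord k.
have o012 : uniq [:: o 0; o 1; o 2; o 3].
  by rewrite -(map_inj_uniq val_inj) /= /o !inordK //; lia.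
have [p [<- <- <- <-]] := exists_perm_map o012 xyz erefl.
apply: strand_tie_perm2; rewrite /o !inordK; try lia.
by rewrite !strand_tieS; apply: (bt_eps_comm bt).
Qed.

Lemma strand_tie_comm (x y z t : 'I_N.+1) :
  strand_tie x y * strand_tie z t = strand_tie z t * strand_tie x y.
Proof.
have [->|xy] := eqVneq x y; first by rewrite strand_tiexx mulr1 mul1r.
have [->|zt] := eqVneq z t; first by rewrite strand_tiexx mulr1 mul1r.
have u3 (i j k : 'I_N.+1) : i != j -> i != k -> j != k -> uniq [:: i; j; k].
  by rewrite /= !inE => /negPf-> /negPf-> /negPf->.
have [xz|xz] := eqVneq x z.
  rewrite -xz in zt *; have [->//|yt] := eqVneq y t.
  by rewrite strand_tieC; case: (strand_tie3 (u3 y x t _ _ _)) => //; rewrite eq_sym.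
have [xt|xt] := eqVneq x t.
  rewrite -xt in zt *; have [->|yz] := eqVneq y z; first by rewrite strand_tieC.
  rewrite strand_tieC (strand_tieC z).
  by case: (strand_tie3 (u3 y x z _ _ _)) => //; rewrite eq_sym.
have [yz|yz] := eqVneq y z.
  by rewrite -yz in zt *; case: (strand_tie3 (u3 x y t _ _ _)).
have [yt|yt] := eqVneq y t.
  rewrite -yt in zt *; rewrite (strand_tieC z).
  by case: (strand_tie3 (u3 x y z _ _ _)).
by apply: strand_tie4; rewrite /= !inE !negb_or xy xz xt yz yt zt.
Qed.

Lemma strand_tie_trans (x y z : 'I_N.+1) :
  strand_tie x y * strand_tie y z = strand_tie x y * strand_tie x z.
Proof.
have [->//|xy] := eqVneq x y.
have [->|yz] := eqVneq y z; first by rewrite strand_tiexx mulr1 strand_tie_idem.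
have [->|xz] := eqVneq x z; first by rewrite strand_tieC strand_tiexx mulr1 strand_tie_idem.
by case: (@strand_tie3 x y z) => //; rewrite /= !inE (negPf xy) (negPf xz) yz.
Qed.

End BraidTies.

(** * Spanning by coset words *)

Section Spanning.
Variables (K : fieldType) (A : algType K) (c : K) (N : nat) (b e : nat -> A).
Hypothesis bt : braid_ties c N b e.
Local Notation E := (strand_tie c b e).

(** Inductive, so that actions and characters can be computed along a derivation. *)
Inductive tie_alg : A -> Prop :=
| tie_alg1 : tie_alg 1
| tie_alg_strand_tie (x y : 'I_N.+1) : tie_alg (E x y)
| tie_algD u w of tie_alg u & tie_alg w : tie_alg (u + w)
| tie_algZ (a : K) u of tie_alg u : tie_alg (a *: u)
| tie_algM u w of tie_alg u & tie_alg w : tie_alg (u * w).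

(* [b_k b_{k-1} ... b_{k-m+1}], for [m <= k+1]: a coset representative of the
   symmetric group on [k+1] strands in the one on [k+2] strands. *)
Fixpoint desc k m : A := if m is m'.+1 then desc k m' * b (k - m') else 1.

(** Normal forms on the first [k+1] strands: one coset word per level, after a coefficient in
    [tie_alg]. Coefficients are indexed by [nat], but only the first [k'+2] enter the sum. *)
Fixpoint layer k : A -> Prop :=
  if k is k'.+1 then fun x => exists y : nat -> A,
    (forall m, layer k' (y m)) /\ x = \sum_(m < k'.+2) y m * desc k' m
  else tie_alg.

Lemma layerM k u x : tie_alg u -> layer k x -> layer k (u * x).
Proof.
move=> Cu; elim: k x => [|k IHk] x /=; first exact: tie_algM.
move=> [y [yk ->]]; exists (fun m => u * y m); split=> [m|]; first exact: IHk.
by rewrite mulr_sumr; apply: eq_bigr => m _; rewrite mulrA.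
Qed.

Lemma layerZ k (a : K) x : layer k x -> layer k (a *: x).
Proof.
move=> kx; rewrite -[x]mul1r scalerAl; apply: layerM => //.
by apply: tie_algZ; apply: tie_alg1.
Qed.

Lemma layerD k x x' : layer k x -> layer k x' -> layer k (x + x').
Proof.
elim: k x x' => [|k IHk] x x' /=; first exact: tie_algD.
move=> [y [yk ->]] [y' [yk' ->]]; exists (fun m => y m + y' m).
split=> [m|]; first exact: IHk.
by rewrite -big_split; apply: eq_bigr => m _; rewrite mulrDl.
Qed.

Lemma layer0 k : layer k 0.
Proof.
elim: k => [|k IHk] /=.
  by rewrite -(scale0r 1); apply: tie_algZ; apply: tie_alg1.
by exists (fun=> 0); split=> //; rewrite big1 // => m _; rewrite mul0r.
Qed.

Lemma layer_desc k y m : (m < k.+2)%N -> layer k y -> layer k.+1 (y * desc k m).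
Proof.
move=> mk ky; exists (fun m' => if m' == m then y else 0).
split=> [m'|]; first by case: eqP => // _; apply: layer0.
rewrite (bigD1 (Ordinal mk)) //= eqxx big1 ?addr0 // => m' m'm.
have /negPf-> : val m' != m by apply: contraNneq m'm => m'm; apply/eqP/val_inj.
by rewrite mul0r.
Qed.

Arguments layer : simpl never.

Lemma layerS k x : layer k x -> layer k.+1 x.
Proof. by move=> /(@layer_desc k x 0 isT); rewrite mulr1. Qed.

Lemma layer1 k : layer k 1.
Proof. by elim: k => [|k]; [apply: tie_alg1|apply: layerS]. Qed.

Lemma desc_strand_tie k m (x y : 'I_N.+1) : (k < N)%N ->
  exists x' y' : 'I_N.+1, desc k m * E x y = E x' y' * desc k m.
Proof.
move=> kN; elim: m x y => [|m IHm] x y; first by exists x, y; rewrite mul1r mulr1.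
have kmN : (k - m < N)%N by lia.
have := b_strand_tie_tperm bt (Ordinal kmN) x y; set s := tperm _ _; move=> /= bE.
have [x' [y' dE]] := IHm (s x) (s y); exists x', y' => /=.
by rewrite -mulrA bE mulrA dE mulrA.
Qed.

Lemma layer_strand_tie k x (i j : 'I_N.+1) : (k <= N)%N ->
  layer k x -> layer k (x * E i j).
Proof.
elim: k x i j => [|k IHk] x i j kN; first by move=> ?; apply: tie_algM => //; constructor.
move=> [y [yk ->]]; rewrite mulr_suml.
apply: (big_ind (layer k.+1)) => [||m _]; [exact: layer0|exact: layerD|].
have [i' [j' dE]] := desc_strand_tie m i j kN.
rewrite -mulrA dE mulrA; apply: layer_desc; first exact: ltn_ord.
by apply: IHk; [apply: ltnW|apply: yk].
Qed.

Lemma desc_b_low k m i : (i + m < k)%N -> GRing.comm (b i) (desc k m).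
Proof.
elim: m => [|m IHm] imk /=; first exact: commr1.
by apply: commrM; [apply: IHm|apply: (comm_bb bt)]; lia.
Qed.

(** [b i] passes to the left over the lower letters until it meets [b i * b i.-1]. The braid
    relation then produces a leading [b i.-1], which commutes with all the letters before it. *)
Lemma desc_b_high k m i : (k < N)%N -> (i <= k)%N -> (k.+1 < i + m)%N ->
  (m <= k.+1)%N -> desc k m * b i = b i.-1 * desc k m.
Proof.
move=> kN ik; elim: m => [|m IHm] kim mk /=; first by lia.
have [kim2|kim2] := ltnP k.+1 (i + m).
  rewrite -mulrA (comm_bb bt); last by lia.
  by rewrite mulrA IHm ?mulrA //; lia.
case: m => [|m] in IHm kim mk kim2 *; first by lia.
have {IHm kim kim2} iE : i = (k - m)%N by lia.
case: i => [|i] in ik iE *; first by lia.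
have -> : (k - m.+1 = i)%N by lia.
rewrite /= -iE -2!(mulrA (desc k m)) -(bt_braid bt); last by lia.
by rewrite !mulrA -desc_b_low //; lia.
Qed.

(** Four cases for a coset word: [b i] commutes with it, passes through it with its index lowered,
    repeats its last letter, or lengthens it. A repeated letter calls for the quadratic relation,
    whose tie is moved left through the word. *)
Lemma layer_b k i x : (i < k)%N -> (k <= N)%N -> layer k x -> layer k (x * b i).
Proof.
elim: k i x => [|k IHk] i x // ik kN [y [yk ->]]; rewrite mulr_suml.
apply: (big_ind (layer k.+1)) => [||[m /= mk] _]; [exact: layer0|exact: layerD|].
rewrite -mulrA; have [imk|imk|imk] := ltngtP (i + m)%N k.
- rewrite -desc_b_low // mulrA; apply: layer_desc => //.
  by apply: IHk; [lia|lia|apply: yk].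
- have [imk1|imk1] := ltnP k.+1 (i + m)%N.
    rewrite desc_b_high; try lia; rewrite mulrA; apply: layer_desc => //.
    by apply: IHk; [lia|lia|apply: yk].
  case: m => [|m] in mk imk imk1 *; first by lia.
  have iE : i = (k - m)%N by lia.
  rewrite /= -iE -(mulrA (desc k m)) (bt_quadratic bt) mulrDr mulr1 mulrDr.
  apply: layerD; first by apply: layer_desc; [lia|apply: yk].
  have iN : (i < N)%N by lia.
  rewrite -!scalerAr; apply: layerZ.
  rewrite -(strand_tieS c b e i) (mulrA (desc k m)).
  have [x' [y' /= ->]] :=
    @desc_strand_tie k m (@strand_lo N.+1 (Ordinal iN)) (@strand_hi N.+1 (Ordinal iN)) kN.
  rewrite -(mulrA (E _ _)).
  have -> : desc k m * b i = desc k m.+1 by rewrite /= -iE.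
  rewrite mulrA.
  by apply: layer_desc => //; apply: layer_strand_tie; [lia|apply: yk].
- have -> : desc k m * b i = desc k m.+1 by rewrite /=; congr (_ * b _); lia.
  by apply: layer_desc; [lia|apply: yk].
Qed.

(** The elements whose right multiplication preserves the last layer form a subalgebra containing
    the generators; [x] is then applied to 1. *)
Lemma layer_full x :
  subalg_gen [set u | exists i, (i < N)%N /\ (u = b i \/ u = e i)]%classic x ->
  layer N x.
Proof.
move=> genx; rewrite -[x]mul1r; move: (layer1 N); move: 1.
suff : forall h, layer N h -> layer N (h * x) by [].
apply: (genx [set z | forall h, layer N h -> layer N (h * z)]%classic); split.
  split=> [|a u w|u w]; rewrite ?inE /=; first by move=> h; rewrite mulr1.
    move=> Lu Lw h Lh; rewrite mulrDr -scalerAr.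
    by apply: layerD; [apply: layerZ; apply: Lu|apply: Lw].
  by move=> Lu Lw h Lh; rewrite mulrA; apply/Lw/Lu.
move=> _ [i [iN [->|->]]] h Lh; first exact: layer_b.
rewrite -(strand_tieS c b e i).
exact: (layer_strand_tie (@strand_lo N.+1 (Ordinal iN)) (@strand_hi N.+1 (Ordinal iN))).
Qed.

End Spanning.

(** * Faithfulness on coloured permutations *)

Section ColouredPermutations.
Variables (d N : nat).

Definition cperm : finType := ({ffun 'I_N.+1 -> 'I_d} * 'S_N.+1)%type.
Implicit Types (x : cperm) (k : 'I_N).

Definition strand_perm k : 'S_N.+1 :=
  tperm (@strand_lo N.+1 k) (@strand_hi N.+1 k).

Definition cp_swap k x : cperm :=
  ([ffun i => x.1 (strand_perm k i)], (strand_perm k * x.2)%g).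

Definition same_colour k x := x.1 (@strand_lo N.+1 k) == x.1 (@strand_hi N.+1 k).

Definition cp_inv k x :=
  same_colour k x && (x.2 (@strand_hi N.+1 k) < x.2 (@strand_lo N.+1 k))%N.

End ColouredPermutations.

Section Faithfulness.
Variables (K : fieldType) (A : algType K) (c : K) (N : nat) (b e : nat -> A).
Hypothesis bt : braid_ties c N b e.
Local Notation E := (strand_tie c b e).
Variables (d M : nat) (N_d : (N < d)%N).
Local Notation X := (cperm d N).
Variables (enc : X -> 'I_M.+1) (dec : 'I_M.+1 -> X).
Hypotheses (encK : cancel enc dec) (decK : cancel dec enc).
Local Notation bx x := (delta_mx 0 (enc x) : 'rV[K]_M.+1).
Variable rho : {lrmorphism A -> 'M[K]_M.+1}.
Hypothesis rho_b : forall (k : 'I_N) (x : X),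
  bx x *m rho (b k) = bx (cp_swap k x) + (c *+ cp_inv k x) *: bx x.
Hypothesis rho_e : forall (k : 'I_N) (x : X),
  bx x *m rho (e k) = (same_colour k x)%:R *: bx x.

(** Matrices act on row vectors, so a word acts letter by letter from left to right. *)
Lemma rho_mul (v : 'rV_M.+1) u w : v *m rho (u * w) = v *m rho u *m rho w.
Proof. by rewrite rmorphM -mulmxA. Qed.

Lemma rho_strand_tie (i j : 'I_N.+1) (x : X) :
  bx x *m rho (E i j) = (x.1 i == x.1 j)%:R *: bx x.
Proof.
have [->|ij] := eqVneq i j; first by rewrite strand_tiexx rmorph1 mulmx1 eqxx scale1r.
wlog lij : i j ij / (i < j)%N.
  move=> th; case: (ltngtP i j) ij => [lij|lij|/val_inj->]; rewrite ?eqxx // => ij.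
    exact: th.
  by rewrite strand_tieC eq_sym; apply: th => //; rewrite eq_sym.
have [m] : exists m, j = (i + m.+1)%N :> nat by exists (j - i.+1)%N; lia.
elim: m j {ij lij} x => [|m IHm] j x jE.
  have kN : (i < N)%N by have := ltn_ord j; lia.
  pose k : 'I_N := Ordinal kN.
  have -> : i = @strand_lo N.+1 k by apply: val_inj.
  have -> : j = @strand_hi N.+1 k by apply: val_inj; rewrite /= jE addn1.
  by rewrite /= strand_tieS; apply: (rho_e k).
have kN : (i + m.+1 < N)%N by have := ltn_ord j; lia.
pose k : 'I_N := Ordinal kN.
have := b_strand_tie_tperm bt k i (@strand_lo N.+1 k) => /=.
rewrite -/(strand_perm k); have -> : strand_perm k i = i.
  by rewrite /strand_perm tpermD // -val_eqE /=; lia.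
have -> : strand_perm k (@strand_lo N.+1 k) = j.
  by rewrite /strand_perm tpermL; apply: val_inj => /=; lia.
move=> bE.
have -> : E i j = b k * E i (@strand_lo N.+1 k) * (b k - c *: e k).
  exact: (conj_of_comm bt).
rewrite !rho_mul rho_b mulmxDl -scalemxAl !IHm //= ffunE ffunE.
have -> : strand_perm k i = i.
  by rewrite /strand_perm tpermD // -val_eqE /=; lia.
have hiE : @strand_hi N.+1 k = j by apply: val_inj => /=; lia.
have -> : strand_perm k (@strand_lo N.+1 k) = j by rewrite /strand_perm tpermL.
set a := (x.1 i == x.1 j)%:R.
(* The correction term is present only if the lower strand has the colour of [j], and then both
   terms carry the same scalar [a]. *)
have -> : (c *+ cp_inv k x) *: ((x.1 i == x.1 (@strand_lo N.+1 k))%:R *: bx x) =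
    a *: ((c *+ cp_inv k x) *: bx x).
  rewrite /cp_inv /same_colour hiE; case: eqP => [->|_].
    by rewrite !scalerA [a * _]mulrC.
  by rewrite !scale0r scaler0.
by rewrite -scalerDr -rho_b -scalemxAl -rho_mul (b_binv bt) rmorph1 mulmx1.
Qed.

Let supp (P : X -> Prop) (v : 'rV[K]_M.+1) := forall x, ~ P x -> v 0 (enc x) = 0.

Let supp_bx (P : X -> Prop) x : P x -> supp P (bx x).
Proof.
move=> Px y nPy; rewrite mxE eqxx /=; case: eqP => // /(can_inj encK) yx.
by rewrite yx in nPy.
Qed.

Let suppZ P a v : supp P v -> supp P (a *: v).
Proof. by move=> Pv x nPx; rewrite mxE Pv // mulr0. Qed.

Let suppD P u v : supp P u -> supp P v -> supp P (u + v).
Proof. by move=> Pu Pv x nPx; rewrite mxE Pu // Pv // addr0. Qed.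

Let supp0 P : supp P 0.
Proof. by move=> x _; rewrite mxE. Qed.

Let supp_sub (P Q : X -> Prop) v : (forall x, P x -> Q x) -> supp P v -> supp Q v.
Proof. by move=> PQ Pv x nQx; apply: Pv => /PQ. Qed.

Let supp_mulmx (P Q : X -> Prop) (B : 'M_M.+1) v :
  (forall x, P x -> supp Q (bx x *m B)) -> supp P v -> supp Q (v *m B).
Proof.
move=> PQ Pv; rewrite [v]row_sum_delta mulmx_suml.
apply: (big_ind (supp Q)) => [||i _]; [exact: supp0|exact: suppD|].
rewrite -scalemxAl -(decK i); have [Pi|nPi] := pselect (P (dec i)).
  by apply: suppZ; apply: PQ.
by rewrite Pv // scale0r; apply: supp0.
Qed.

Let fixes_above k (x : X) := forall i : 'I_N.+1, (k < i)%N -> x.2 i = i.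

(* [desc b k m] brings the value [k.+1] from position [k.+1] to [k.+1 - m]. *)
Let has_top_at k m (x : X) := fixes_above k.+1 x /\
  forall i : 'I_N.+1, i = (k.+1 - m)%N :> nat -> x.2 i = k.+1 :> nat.

Let supp_desc k m v : (k < N)%N -> (m <= k.+1)%N -> supp (fixes_above k) v ->
  supp (has_top_at k m) (v *m rho (desc b k m)).
Proof.
move=> kN; elim: m => [|m IHm] mk fv.
  rewrite rmorph1 mulmx1; apply: supp_sub fv => x fx.
  split=> [i ki|i]; first by apply: fx; lia.
  by rewrite subn0 => ik; rewrite fx ik.
rewrite rho_mul; move/(_ (ltnW mk) fv): IHm; apply: supp_mulmx => x [fx tx].
have kmN : (k - m < N)%N by lia.
pose l : 'I_N := Ordinal kmN; rewrite (rho_b l).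
have top_hi : x.2 (@strand_hi N.+1 l) = k.+1 :> nat by apply: tx => /=; lia.
have lo_hi : @strand_lo N.+1 l != @strand_hi N.+1 l by rewrite -val_eqE /=; lia.
(* A descent would place a value above [k+1] at the lower position. Such values are fixed, so the
   position itself would exceed [k+1]. Hence no correction term arises. *)
have -> : cp_inv l x = false.
  apply/negP => /andP[_]; rewrite top_hi => gt_lo.
  by have /perm_inj lo_fix := fx _ gt_lo; rewrite lo_fix /= in gt_lo; lia.
rewrite mulr0n scale0r addr0; apply: supp_bx; split=> [i ki|i iE] /=; rewrite permM.
  rewrite {1}/strand_perm tpermD ?fx // -val_eqE /=; apply/eqP; lia.
have -> : i = @strand_lo N.+1 l by apply: val_inj => /=; lia.
by rewrite /strand_perm tpermL.
Qed.

Let supp_layer k y al : layer c N b e k y -> (k <= N)%N ->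
  supp (fixes_above k) (bx (al, 1%g : 'S_N.+1) *m rho y).
Proof.
elim: k y => [|k IHk] y.
  move=> Cy _; apply: (@supp_sub (fun x => x.2 = 1%g)).
    by move=> x x1 i _; rewrite x1 perm1.
  have: supp (fun x => x.2 = 1%g) (bx (al, 1%g : 'S_N.+1)) by apply: supp_bx.
  move: (bx _) => v; elim: Cy v => [|i j|u w _ IHu _ IHw|a u _ IHu|u w _ IHu _ IHw] v fv.
  - by rewrite rmorph1 mulmx1.
  - apply: supp_mulmx fv => x fx; rewrite rho_strand_tie.
    by apply: suppZ; apply: supp_bx.
  - by rewrite rmorphD mulmxDr; apply: suppD; [apply: IHu|apply: IHw].
  - by rewrite linearZ -scalemxAr; apply: suppZ; apply: IHu.
  - by rewrite rho_mul; apply/IHw/IHu.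
move=> [u [uk ->]] kN; rewrite raddf_sum mulmx_sumr.
apply: (big_ind (supp _)) => [||m _]; [exact: supp0|exact: suppD|].
rewrite rho_mul.
apply: (@supp_sub (has_top_at k m)) => [x []//|].
have mk := ltn_ord m; apply: supp_desc => //.
by apply: IHk; [apply: uk|apply: ltnW].
Qed.

(** One scalar serves two purposes: the action of [y] on the basis vectors coloured by [al], and
    right multiplication by [y] on any joint eigenvector [z] in [A] of the same type. This carries
    vanishing in the representation back to the algebra. *)
Let diagonal_char y (al : {ffun 'I_N.+1 -> 'I_d}) : tie_alg c N b e y -> exists a : K,
  (forall s, bx (al, s) *m rho y = a *: bx (al, s)) /\
  (forall z, (forall i j : 'I_N.+1, z * E i j = (al i == al j)%:R *: z) ->
    z * y = a *: z).
Proof.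
elim=> [|i j|u w _ [a [au zu]] _ [a' [aw zw]]|a u _ [a' [au zu]]
       |u w _ [a [au zu]] _ [a' [aw zw]]].
- by exists 1; split=> [s|z _]; rewrite ?rmorph1 ?mulmx1 ?mulr1 scale1r.
- by exists (al i == al j)%:R; split=> [s|z]; [apply: rho_strand_tie|apply].
- exists (a + a'); split=> [s|z zE]; first by rewrite rmorphD mulmxDr au aw scalerDl.
  by rewrite mulrDr zu ?zw ?scalerDl.
- exists (a * a'); split=> [s|z zE]; first by rewrite linearZ -scalemxAr au scalerA.
  by rewrite -scalerAr zu ?scalerA.
- exists (a * a'); split=> [s|z zE].
    by rewrite rho_mul au -scalemxAl aw scalerA.
  by rewrite mulrA zu // -scalerAl zw // scalerA.
Qed.

Let pure z (i j : 'I_N.+1) := z * E i j = z \/ z * E i j = 0.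

(** By transitivity, the ties that fix [z] define an equivalence relation on strands. Each strand is
    coloured by a chosen representative of its class, which is a valid colour because [N < d]. *)
Lemma pure_colouring z : z != 0 -> (forall i j, pure z i j) ->
  exists al : {ffun 'I_N.+1 -> 'I_d},
    forall i j : 'I_N.+1, z * E i j = (al i == al j)%:R *: z.
Proof.
move=> z0 pz; pose r (i j : 'I_N.+1) := z * E i j == z.
have rr i : r i i by rewrite /r strand_tiexx mulr1.
have rs i j : r i j = r j i by rewrite /r strand_tieC.
have rt i j k : r i j -> r j k -> r i k.
  move=> /eqP rij /eqP rjk; apply/eqP.
  by rewrite -{1}rij -mulrA -(strand_tie_trans bt) mulrA rij.
exists [ffun i => widen_ord N_d (choose (r i) i)] => i j; rewrite !ffunE.
rewrite -val_eqE /= val_eqE.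
have -> : (choose (r i) i == choose (r j) j) = r i j.
  apply/eqP/idP => [ch|rij].
    apply: (rt _ (choose (r i) i)); first exact: chooseP.
    by rewrite ch rs; apply: chooseP.
  have rij_eq : r i =1 r j.
    by move=> k; apply/idP/idP; apply: rt; rewrite // rs.
  by rewrite (eq_choose rij_eq); apply: choose_id; rewrite // -rij_eq.
rewrite /r; case: (pz i j) => ->; first by rewrite eqxx scale1r.
by rewrite eq_sym (negPf z0) scale0r.
Qed.

Let tie_alg_faithful y : tie_alg c N b e y ->
  (forall al, bx (al, 1%g : 'S_N.+1) *m rho y = 0) -> y = 0.
Proof.
move=> Cy y0; pose T : finType := ('I_N.+1 * 'I_N.+1)%type.
(* Along [L], [z] is split into [z E] and [z - z E], one pair of strands at a
   time, until it is pure for all of them. *)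
suff ind (L : seq T) z :
    (forall p : T, p \notin L -> pure z p.1 p.2) -> z * y = 0.
  by rewrite -[y]mul1r; apply: (ind (enum T)) => p; rewrite mem_enum.
elim: L z => [|p L IHL] z pz.
  have [->|z0] := eqVneq z 0; first by rewrite mul0r.
  have [|al alE] := @pure_colouring z z0; first by move=> i j; apply: (pz (i, j)).
  (* The scalar by which [y] acts on [z] also gives its action on the basis vector of [al], hence is
     0. *)
  have [a [rho_y ->//]] := diagonal_char al Cy.
  have := rho_y 1%g; rewrite y0 => /rowP/(_ (enc (al, 1%g))).
  by rewrite !mxE !eqxx mulr1 => <-; rewrite scale0r.
(* Idempotence makes both pieces pure for [p]; commutativity of the ties keeps the pairs that were
   already pure. *)
have pzE (p' : T) : p' \notin L ->
    pure (z * E p.1 p.2) p'.1 p'.2 /\ pure (z - z * E p.1 p.2) p'.1 p'.2.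
  move=> p'L; rewrite /pure; have [->|p'p] := eqVneq p' p.
    rewrite mulrBl -!mulrA (strand_tie_idem bt); split; first by left.
    by right; rewrite subrr.
  have : p' \notin p :: L by rewrite inE negb_or p'p.
  rewrite mulrBl -!mulrA (strand_tie_comm bt p.1) !mulrA => /pz [->|->].
    by split; left.
  by rewrite mul0r subr0; split; right.
rewrite -[z](subrK (z * E p.1 p.2)) mulrDl.
by rewrite !IHL ?addr0 // => p' /pzE[].
Qed.

(** The summands with different [m] have disjoint supports, since they carry the value [k+1] at
    different positions. So each summand acts by 0, the invertible coset word can be cancelled, and
    the coefficient falls to the induction. *)
Lemma layer_faithful k y : (k <= N)%N -> layer c N b e k y ->
  (forall al, bx (al, 1%g : 'S_N.+1) *m rho y = 0) -> y = 0.
Proof.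
elim: k y => [|k IHk] y; first by move=> _; apply: tie_alg_faithful.
move=> kN [u [uk ->]] y0; rewrite big1 // => m _.
suff -> : u m = 0 by rewrite mul0r.
apply: IHk (ltnW kN) (uk m) _ => al.
have desc_inv m' : exists w, desc b k m' * w = 1.
  elim: m' => [|m' [w dw]]; first by exists 1; rewrite mulr1.
  by exists ((b (k - m') - c *: e (k - m')) * w); rewrite /= mulrA
    -(mulrA (desc _ _ _)) (b_binv bt) mulr1.
have [w dw] := desc_inv m.
rewrite -[u m]mulr1 -dw mulrA rho_mul.
suff -> : bx (al, 1%g : 'S_N.+1) *m rho (u m * desc b k m) = 0 by rewrite mul0mx.
have supp_u (m' : 'I_k.+2) :
    supp (has_top_at k m') (bx (al, 1%g : 'S_N.+1) *m rho (u m' * desc b k m')).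
  have m'k := ltn_ord m'; rewrite rho_mul; apply: supp_desc => //.
  by apply: supp_layer; [apply: uk|apply: ltnW].
apply/rowP => i; rewrite -(decK i); have [Px|nPx] := pselect (has_top_at k m (dec i)).
  have := y0 al; rewrite raddf_sum mulmx_sumr => /rowP/(_ (enc (dec i))).
  rewrite summxE (bigD1 m) //= big1 ?addr0 // => m' m'm; apply: supp_u => Px'.
  have mk := ltn_ord m; have m'k := ltn_ord m'.
  have tm : (k.+1 - m < N.+1)%N by lia.
  have tm' : (k.+1 - m' < N.+1)%N by lia.
  have := etrans (Px.2 (Ordinal tm) erefl) (esym (Px'.2 (Ordinal tm') erefl)).
  move=> /val_inj/perm_inj/(congr1 val) /= mm'.
  by case/negP: m'm; rewrite -val_eqE /=; apply/eqP; lia.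
by rewrite supp_u // mxE.
Qed.

End Faithfulness.

(** * Relations in the Yokonuma-Hecke algebra *)

Section TieElements.
Variables (K : fieldType) (A : algType K) (d : nat).
Implicit Types x y g : A.

(** The terms at [s = 0] and [s = d] both equal 1, so the summation range can be shifted by one. *)
Let shift_sum x y : x ^+ d = 1 -> y ^+ d = 1 ->
  \sum_(s < d) x ^+ s * y ^+ (d - s) = \sum_(s < d) x ^+ s.+1 * y ^+ (d - s.+1).
Proof.
move=> xd yd; pose f s := x ^+ s * y ^+ (d - s).
have /= := etrans (esym (@big_ord_recr _ _ +%R d (fun s => f s)))
  (big_ord_recl d (fun s => f s)).
by rewrite /f /= subn0 subnn xd yd mulr1 addrC => /addrI.
Qed.

Lemma tie_eltC x y : GRing.comm x y -> x ^+ d = 1 -> y ^+ d = 1 ->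
  tie_elt d x y = tie_elt d y x.
Proof.
move=> xy xd yd; rewrite /tie_elt shift_sum // (reindex_inj rev_ord_inj) /=.
congr (_ *: _); apply: eq_bigr => s _; have sd := ltn_ord s.
by rewrite subnSK // subKn 1?ltnW //; apply/commrX/commr_sym/commrX/commr_sym.
Qed.

Lemma tie_elt_absorb x y : GRing.comm x y -> x ^+ d = 1 -> y ^+ d = 1 ->
  x * tie_elt d x y = y * tie_elt d x y.
Proof.
move=> xy xd yd; rewrite /tie_elt -!scalerAr; congr (_ *: _).
rewrite [in RHS]shift_sum // !mulr_sumr; apply: eq_bigr => s _.
have yX : y * x ^+ s.+1 = x ^+ s.+1 * y by apply/commrX/commr_sym.
by rewrite !mulrA -exprS yX -mulrA -exprS subnSK.
Qed.

Lemma tie_elt_intertwine g x y x' y' : g * x = x' * g -> g * y = y' * g ->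
  g * tie_elt d x y = tie_elt d x' y' * g.
Proof.
move=> gx gy; have gX u u' m : g * u = u' * g -> g * u ^+ m = u' ^+ m * g.
  move=> gu; elim: m => [|m IHm]; first by rewrite mulr1 mul1r.
  by rewrite !exprS mulrA gu -mulrA IHm mulrA.
rewrite /tie_elt -scalerAr -scalerAl mulr_sumr mulr_suml; congr (_ *: _).
by apply: eq_bigr => s _; rewrite mulrA (gX _ _ _ gx) -mulrA (gX _ _ _ gy) mulrA.
Qed.

(** Next to [tie_elt d x y], the elements [x] and [y] are interchangeable by absorption, so every
    power of [y] can be replaced by that of [x]. *)
Lemma tie_elt_trans x y z :
  GRing.comm x y -> GRing.comm x z -> GRing.comm y z -> x ^+ d = 1 -> y ^+ d = 1 ->
  tie_elt d x y * tie_elt d y z = tie_elt d x y * tie_elt d x z.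
Proof.
move=> xy xz yz xd yd; pose t := tie_elt d x y.
have comm_t u : GRing.comm u x -> GRing.comm u y -> u * t = t * u.
  by move=> ux uy; apply: tie_elt_intertwine.
have tX s : t * y ^+ s = t * x ^+ s.
  elim: s => // s IHs; rewrite !exprSr !mulrA IHs -!mulrA.
  rewrite -(commrX s (commr_sym xy)) -(commrX s (commr_refl x)) !mulrA.
  by rewrite -!comm_t // ?tie_elt_absorb //; apply/commr_sym.
rewrite -/t /(tie_elt d y z) /(tie_elt d x z) -!scalerAr !mulr_sumr.
by congr (_ *: _); apply: eq_bigr => s _; rewrite !mulrA tX.
Qed.

End TieElements.

Section YokonumaRelations.
Variables (K : fieldType) (q : K) (q0 : q != 0) (d n : nat).

Local Notation g := (@Y_g K q q0 d n).
Local Notation t := (@Y_t K q q0 d n).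
Implicit Types (i j : 'I_n.-1).
Local Notation pi := (quot_pi (@YH_proper K q q0 d n)).

Lemma Y_framing_order (j : 'I_n) : t j ^+ d = 1.
Proof. by rewrite -rmorphXn -(rmorph1 pi); apply/YH_relP; constructor. Qed.

Lemma Y_framing_comm (j k : 'I_n) : GRing.comm (t j) (t k).
Proof. by rewrite /GRing.comm -!rmorphM; apply/YH_relP; constructor. Qed.

Lemma Y_mixed i (j : 'I_n) : g i * t j = t (tperm (strand_lo i) (strand_hi i) j) * g i.
Proof. by rewrite -!rmorphM; apply/YH_relP; constructor. Qed.

Lemma Y_quadratic i : g i * g i = 1 + (q - q^-1) *: (Y_e q0 d i * g i).
Proof.
rewrite -expr2 -rmorphXn /Y_e /Y_t -rmorph_tie_elt -rmorphM /= -linearZ /=.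
by rewrite -(rmorph1 pi) -rmorphD; apply/YH_relP; constructor.
Qed.

Lemma Y_comm i j : distant i j -> g i * g j = g j * g i.
Proof. by move=> ij; rewrite -!rmorphM; apply/YH_relP; constructor. Qed.

Lemma Y_braid i j : adjacent i j -> g i * g j * g i = g j * g i * g j.
Proof. by move=> ij; rewrite -!rmorphM; apply/YH_relP; constructor. Qed.

Let te (j k : 'I_n) := tie_elt d (t j) (t k).

Let teC (j k : 'I_n) : te j k = te k j.
Proof. by apply: tie_eltC; rewrite ?Y_framing_order //; apply: Y_framing_comm. Qed.

Let te_trans (j k l : 'I_n) : te j k * te k l = te j k * te j l.
Proof.
by apply: tie_elt_trans; rewrite ?Y_framing_order //; apply: Y_framing_comm.
Qed.

Let te_comm (j k l m : 'I_n) : te j k * te l m = te l m * te j k.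
Proof.
have t_te (i : 'I_n) : GRing.comm (t i) (te l m).
  by apply: tie_elt_intertwine; apply: Y_framing_comm.
by apply/esym; apply: tie_elt_intertwine; apply/commr_sym.
Qed.

Let g_te i (j k : 'I_n) : g i * te j k =
  te (tperm (strand_lo i) (strand_hi i) j) (tperm (strand_lo i) (strand_hi i) k) * g i.
Proof. by apply: tie_elt_intertwine; apply: Y_mixed. Qed.

Lemma Y_e_comm i j : Y_e q0 d i * Y_e q0 d j = Y_e q0 d j * Y_e q0 d i.
Proof. exact: te_comm. Qed.

Lemma Y_e_g i : Y_e q0 d i * g i = g i * Y_e q0 d i.
Proof. by rewrite g_te tpermL tpermR teC. Qed.

Lemma Y_e_g_comm i j : distant i j -> Y_e q0 d i * g j = g j * Y_e q0 d i.
Proof.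
by rewrite /distant => ij; rewrite g_te !tpermD // -val_eqE /=; lia.
Qed.

Let te_tri (j k l : 'I_n) : te j k * te j l = te k l * te j l.
Proof.
by rewrite -te_trans te_comm (teC k l) (teC j k) (teC j l) te_trans.
Qed.

(** Treats both orders of two neighbours at once: [y] is the shared strand. *)
Let adjacent_strands i j : adjacent i j -> exists x y z : 'I_n,
  [/\ [/\ x != y, x != z & y != z],
      tperm (strand_lo i) (strand_hi i) = tperm x y,
      tperm (strand_lo j) (strand_hi j) = tperm y z,
      Y_e q0 d i = te x y & Y_e q0 d j = te y z].
Proof.
case/orP => /eqP ij.
  exists (strand_lo i), (strand_hi i), (strand_hi j).
  have jE : strand_lo j = strand_hi i by apply: val_inj.
  split; [by split; rewrite -val_eqE /=; lia|by []|by rewrite jE|by []|].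
  by rewrite /Y_e jE.
exists (strand_hi i), (strand_lo i), (strand_lo j).
have jE : strand_hi j = strand_lo i by apply: val_inj.
split; [by split; rewrite -val_eqE /=; lia|by rewrite tpermC|by rewrite jE tpermC| |].
  exact: teC.
by rewrite /Y_e jE; apply: teC.
Qed.

Lemma Y_tie1 i j : adjacent i j ->
  Y_e q0 d i * Y_e q0 d j * g i = g i * Y_e q0 d i * Y_e q0 d j.
Proof.
move=> ij; have [x [y [z [[xy xz yz] si _ ei ej]]]] := adjacent_strands ij.
rewrite -Y_e_g -[RHS]mulrA ei ej g_te si tpermR tpermD // mulrA.
by rewrite te_trans.
Qed.

Lemma Y_tie2 i j : adjacent i j ->
  g i * Y_e q0 d i * Y_e q0 d j = Y_e q0 d j * g i * Y_e q0 d j.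
Proof.
move=> ij; have [x [y [z [[xy xz yz] si _ ei ej]]]] := adjacent_strands ij.
rewrite -Y_e_g -mulrA -[RHS]mulrA ei ej g_te si tpermR tpermD // !mulrA.
by rewrite te_tri.
Qed.

Lemma Y_slide i j : adjacent i j ->
  Y_e q0 d i * g j * g i = g j * g i * Y_e q0 d j.
Proof.
move=> ij; have [x [y [z [[xy xz yz] si sj ei ej]]]] := adjacent_strands ij.
rewrite -[RHS]mulrA ei ej g_te si tpermR tpermD // !mulrA g_te sj.
by rewrite tpermR tpermD // eq_sym.
Qed.

End YokonumaRelations.

(** * The representation on coloured permutations *)

(** The size is written as a successor so that the square matrices form a nonzero algebra. *)
Lemma fin_coding (T : finType) (x0 : T) :
  exists (enc : T -> 'I_(#|T|.-1.+1)) (dec : 'I_(#|T|.-1.+1) -> T),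
    cancel enc dec /\ cancel dec enc.
Proof.
have T0 : #|T|.-1.+1 = #|T| by rewrite prednK //; apply/card_gt0P; exists x0.
exists (fun x => cast_ord (esym T0) (enum_rank x)).
exists (fun i => enum_val (cast_ord T0 i)).
by split=> i; rewrite ?cast_ordKV ?enum_rankK ?enum_valK ?cast_ordK.
Qed.

Section Representation.
Variables (K : fieldType) (q : K) (q0 : q != 0) (d N M : nat).
Local Notation X := (cperm d N).
Variables (enc : X -> 'I_M.+1) (dec : 'I_M.+1 -> X).
Hypotheses (encK : cancel enc dec) (decK : cancel dec enc).
Local Notation bx x := (delta_mx 0 (enc x) : 'rV[K]_M.+1).
Variables (z : K) (zprim : d.-primitive_root z).
Hypothesis d0 : d%:R != 0 :> K.
Let c := q - q^-1.
Implicit Types (x : X) (k l : 'I_N).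

(** Extends [cp_inv] to arbitrary pairs of positions, so that a swap of [x] only moves the two
    positions. *)
Let inv (i j : 'I_N.+1) x := (x.1 i == x.1 j) && (x.2 j < x.2 i)%N.

Let G k : 'M[K]_M.+1 := \matrix_(i < M.+1)
  (bx (cp_swap k (dec i)) + (c *+ cp_inv k (dec i)) *: bx (dec i)).

Let T (j : 'I_N.+1) : 'M[K]_M.+1 := \matrix_(i < M.+1) (z ^+ (dec i).1 j *: bx (dec i)).

Let bxG k x : bx x *m G k = bx (cp_swap k x) + (c *+ cp_inv k x) *: bx x.
Proof. by rewrite -rowE rowK encK. Qed.

Let bxT j x : bx x *m T j = z ^+ x.1 j *: bx x.
Proof. by rewrite -rowE rowK encK. Qed.

Let mx_ext (B C : 'M[K]_M.+1) : (forall x, bx x *m B = bx x *m C) -> B = C.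
Proof. by move=> BC; apply/row_matrixP => i; rewrite !rowE -(decK i). Qed.

Let bxM x (B C : 'M[K]_M.+1) : bx x *m (B * C) = bx x *m B *m C.
Proof. exact: mulmxA. Qed.

Let cp_swap1 k x i : (cp_swap k x).1 i = x.1 (strand_perm k i).
Proof. by rewrite ffunE. Qed.

Let cp_swap2 k x i : (cp_swap k x).2 i = x.2 (strand_perm k i).
Proof. by rewrite permM. Qed.

Let inv_swap k x i j : inv i j (cp_swap k x) = inv (strand_perm k i) (strand_perm k j) x.
Proof. by rewrite /inv !cp_swap1 !cp_swap2. Qed.

Let cp_ext x x' : (forall i, x.1 i = x'.1 i) -> (forall i, x.2 i = x'.2 i) -> x = x'.
Proof.
by case: x x' => [al s] [al' s'] /= ? ?; congr pair; [apply/ffunP|apply/permP].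
Qed.

Let swap_swap k x : cp_swap k (cp_swap k x) = x.
Proof. by apply: cp_ext => i; rewrite ?cp_swap1 ?cp_swap2 tpermK. Qed.

Let bxTn j m x : bx x *m (T j ^+ m) = (z ^+ x.1 j) ^+ m *: bx x.
Proof.
elim: m => [|m IHm]; first by rewrite expr0 mulmx1 scale1r.
by rewrite exprS bxM bxT -scalemxAl IHm scalerA exprS.
Qed.

Let zd : z ^+ d = 1. Proof. exact: prim_expr_order. Qed.

Let T_order j : T j ^+ d = 1.
Proof.
by apply: mx_ext => x; rewrite bxTn mulmx1 -exprM mulnC exprM zd expr1n scale1r.
Qed.

Let T_comm i j : T i * T j = T j * T i.
Proof.
by apply: mx_ext => x; rewrite !bxM !bxT -!scalemxAl !bxT !scalerA mulrC.
Qed.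

Let ord_neq (i j : 'I_N.+1) : i != j :> nat -> i != j.
Proof. by apply: contraNneq => ->. Qed.

Let GT k j : G k * T j = T (strand_perm k j) * G k.
Proof.
apply: mx_ext => x; rewrite !bxM bxG bxT mulmxDl -!scalemxAl !bxT bxG.
rewrite scalerDr cp_swap1 !scalerA; congr (_ + _ *: _); rewrite mulrC.
rewrite /cp_inv /same_colour; case: eqP => [same|_]; last by rewrite !mulr0.
congr (_ ^+ _ * _); rewrite /strand_perm; case: tpermP => [->|->|//]; by rewrite same.
Qed.

Let bx_tie (j k : 'I_N.+1) x :
  bx x *m tie_elt d (T j) (T k) = (x.1 j == x.1 k)%:R *: bx x.
Proof.
pose w : regular_alg K := z ^+ x.1 j; pose w' : regular_alg K := z ^+ x.1 k.
have -> : bx x *m tie_elt d (T j) (T k) = (tie_elt d w w' : K) *: bx x.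
  rewrite /tie_elt -scalemxAr mulmx_sumr -scalerA scaler_suml; congr (_ *: _).
  by apply: eq_bigr => s _; rewrite bxM bxTn -scalemxAl bxTn scalerA.
congr (_ *: _); have wd (i : 'I_N.+1) : (z ^+ x.1 i : regular_alg K) ^+ d = 1.
  by rewrite -[LHS]/((z ^+ x.1 i) ^+ d) -exprM mulnC exprM zd expr1n.
have [jk|jk] := eqVneq (x.1 j) (x.1 k).
  rewrite /w' -jk -/w /tie_elt (eq_bigr (fun=> 1)) => [|s _].
    by rewrite sumr_const card_ord; apply: mulVf.
  by rewrite -exprD subnKC ?wd // ltnW.
(* For different colours, absorption makes the scalar a zero of multiplication by [w - w'], which is
   nonzero because [z] is primitive. *)
have := @tie_elt_absorb _ _ d w w' (mulrC _ _) (wd j) (wd k).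
move/eqP; rewrite -subr_eq0 -mulrBl mulf_eq0 => /orP[|/eqP//].
rewrite subr_eq0 (eq_prim_root_expr zprim) !modn_small // => /eqP/val_inj/eqP.
by rewrite (negPf jk).
Qed.

Let cp_swap_comm k l x : @distant N.+1 k l ->
  cp_swap k (cp_swap l x) = cp_swap l (cp_swap k x).
Proof.
rewrite /distant /= => kl.
have skl : commute (strand_perm k) (strand_perm l).
  apply/commgP/conjg_fixP; rewrite tpermJ.
  by rewrite /strand_perm !tpermD //; apply: ord_neq => /=; lia.
by apply: cp_ext => i; rewrite !(cp_swap1, cp_swap2) -!permM skl.
Qed.

Let cp_inv_swap_distant k l x : @distant N.+1 k l ->
  cp_inv l (cp_swap k x) = cp_inv l x.
Proof.
rewrite /distant /= => kl; rewrite -[LHS]/(inv _ _ _) inv_swap.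
by rewrite /strand_perm !tpermD //; apply: ord_neq => /=; lia.
Qed.

Let G_comm k l : @distant N.+1 k l -> G k * G l = G l * G k.
Proof.
move=> kl; have lk : @distant N.+1 l k by rewrite /distant orbC.
apply: mx_ext => x; rewrite !bxM !bxG !mulmxDl -!scalemxAl !bxG.
rewrite (cp_inv_swap_distant _ kl) (cp_inv_swap_distant _ lk) (cp_swap_comm _ kl).
move: (bx _) (bx _) (bx _) (bx _) (c *+ _) (c *+ _) => u1 u2 u3 u4 a1 a2.
by apply/rowP => i; rewrite !mxE; ring.
Qed.

Let G_quadratic k : let j := @strand_lo N.+1 k in let j' := @strand_hi N.+1 k in
  G k ^+ 2 = 1 + c *: (tie_elt d (T j) (T j') * G k).
Proof.
move=> j j'; apply: mx_ext => x; rewrite expr2 bxM bxG mulmxDl -scalemxAl !bxG.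
rewrite mulmxDr mulmx1 -scalemxAr bxM bx_tie -scalemxAl bxG swap_swap.
have -> : cp_inv k (cp_swap k x) = inv j' j x.
  by rewrite -[LHS]/(inv _ _ _) inv_swap /strand_perm tpermL tpermR.
have nj : x.2 j != x.2 j' by rewrite (inj_eq perm_inj); apply: ord_neq => /=; lia.
rewrite /cp_inv /inv /same_colour -/j -/j' eq_sym; case: eqP => _ /=; last first.
  by rewrite !mulr0n !scale0r !scaler0 !addr0.
(* For equal colours, exactly one of [x] and its swap has a descent at [k]. *)
case: (ltngtP (x.2 j) (x.2 j')) nj => [_ _|_ _|/val_inj->]; last by rewrite eqxx.
  by rewrite /= ?mulr0n ?mulr1n ?scale0r ?addr0 ?scale1r ?add0r.
by rewrite /= ?mulr0n ?mulr1n ?scale0r ?addr0 ?scale1r ?add0r.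
Qed.

Let G_braid_lt k l : l = k.+1 :> nat -> G k * G l * G k = G l * G k * G l.
Proof.
move=> kl; pose i1 := @strand_lo N.+1 k; pose i2 := @strand_hi N.+1 k.
pose i3 := @strand_hi N.+1 l.
have l2 : @strand_lo N.+1 l = i2 by apply: val_inj.
have [n12 n13 n23] : [/\ i1 != i2, i1 != i3 & i2 != i3].
  by split; apply: ord_neq; rewrite /i1 /i2 /i3 /= ?kl; apply/eqP; lia.
have [sk1 sk2 sk3] : [/\ strand_perm k i1 = i2, strand_perm k i2 = i1 &
    strand_perm k i3 = i3].
  by rewrite /strand_perm -/i1 -/i2 tpermL tpermR tpermD.
have [sl1 sl2 sl3] : [/\ strand_perm l i1 = i1, strand_perm l i2 = i3 &
    strand_perm l i3 = i2].
  by rewrite /strand_perm l2 -/i3 tpermL tpermR tpermD // eq_sym.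
have skE : strand_perm k = tperm i1 i2 by [].
have slE : strand_perm l = tperm i2 i3 by rewrite /strand_perm l2.
have klk x : cp_swap k (cp_swap l (cp_swap k x)) = cp_swap l (cp_swap k (cp_swap l x)).
  have sE : (strand_perm k * strand_perm l * strand_perm k =
             strand_perm l * strand_perm k * strand_perm l)%g.
    have conjE (s t : 'S_N.+1) : (s^-1 = s)%g -> (s * t * s = t ^ s)%g.
      by rewrite /conjg => ->; rewrite mulgA.
    rewrite !conjE ?skE ?slE ?tpermV // !tpermJ !tpermL !tpermR !tpermD //;
      by rewrite eq_sym.
  by apply: cp_ext => i; rewrite !(cp_swap1, cp_swap2) -!permM !mulgA sE.
have invk x : cp_inv k x = inv i1 i2 x by [].
have invl x : cp_inv l x = inv i2 i3 x by rewrite /cp_inv /same_colour l2.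
apply: mx_ext => x.
(* Both sides are expanded in the basis; all coefficients become products of inversions of [x] among
   the strands [i1], [i2], [i3]. *)
rewrite !bxM !bxG !(mulmxDl, bxG) -!scalemxAl !bxG !(mulmxDl, bxG) -!scalemxAl !bxG.
rewrite !swap_swap klk !(invk, invl) !inv_swap !(sk1, sk2, sk3, sl1, sl2, sl3).
have nv (i j : 'I_N.+1) : i != j -> x.2 i != x.2 j :> nat.
  by apply: contra => /eqP/val_inj/perm_inj->.
have [v12 v13 v23] : [/\ x.2 i1 != x.2 i2 :> nat, x.2 i1 != x.2 i3 :> nat &
    x.2 i2 != x.2 i3 :> nat] by split; apply: nv.
(* Equality of the coefficients of [s_k] and [s_l]; the others agree termwise. *)
have : (inv i1 i2 x && inv i2 i3 x + inv i1 i3 x && inv i2 i1 x =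
  inv i2 i3 x && inv i1 i3 x :> nat)%N.
  rewrite /inv (eq_sym (x.1 i2) (x.1 i1)).
  have [->|n12'] := eqVneq (x.1 i1) (x.1 i2); last first.
    by rewrite /= andbF; case: eqVneq => //= <-; rewrite (negPf n12') /= andbF.
  case: (_ == _); rewrite /= ?andbF //; move: v12 v13 v23.
  by case: ltngtP => // ? _; case: ltngtP => // ? _; case: ltngtP => //= ? _; lia.
have : (inv i1 i2 x && inv i1 i3 x =
  inv i1 i2 x && inv i2 i3 x + inv i1 i3 x && inv i3 i2 x :> nat)%N.
  rewrite /inv (eq_sym (x.1 i3) (x.1 i2)).
  have [<-|n23'] := eqVneq (x.1 i2) (x.1 i3); last first.
    by rewrite /= !andbF; case: eqVneq => //= ->; rewrite (negPf n23') /= andbF.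
  case: (_ == _); rewrite /= ?andbF //; move: v12 v13 v23.
  by case: ltngtP => // ? _; case: ltngtP => // ? _; case: ltngtP => //= ? _; lia.
move: (bx _) (bx _) (bx _) (bx _) (bx _) (bx _) => u1 u2 u3 u4 u5 u6.
move: (inv i1 i2 x) (inv i2 i1 x) (inv i1 i3 x) (inv i2 i3 x) (inv i3 i2 x).
by do 5!case; move=> /= e1 e2 //; rewrite ?mulr0n ?mulr1n; apply/rowP => i;
  rewrite !mxE; ring.
Qed.

Let G_braid k l : @adjacent N.+1 k l -> G k * G l * G k = G l * G k * G l.
Proof. by case/orP=> /eqP kl; [|apply/esym]; apply: G_braid_lt. Qed.

Let gens (u : Y_gen N.+1) : 'M[K]_M.+1 :=
  match u with inl k => G k | inr j => T j end.

Let gens_rel u : relators (Y_rel q d (n := N.+1)) u -> free_eval gens u = 0.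
Proof.
move=> [l [r [lr ->]]]; rewrite rmorphB /=; apply/eqP; rewrite subr_eq0; apply/eqP.
case: lr => [i j ij|i j ij|j|j k|i j|i].
- by rewrite !rmorphM /= !free_evalE; apply: G_comm.
- by rewrite !rmorphM /= !free_evalE; apply: G_braid.
- by rewrite rmorphXn rmorph1 /= free_evalE; apply: T_order.
- by rewrite !rmorphM /= !free_evalE; apply: T_comm.
- by rewrite !rmorphM /= !free_evalE; apply: GT.
- rewrite rmorphXn rmorphD /= rmorph1 linearZ /= rmorphM /= rmorph_tie_elt !free_evalE.
  exact: G_quadratic.
Qed.

Lemma YH_rep : exists rho : {lrmorphism YH q0 d N.+1 -> 'M[K]_M.+1},
  (forall (k : 'I_N) x, bx x *m rho (@Y_g K q q0 d N.+1 k) =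
     bx (cp_swap k x) + (c *+ cp_inv k x) *: bx x) /\
  (forall (k : 'I_N) x, bx x *m rho (@Y_e K q q0 d N.+1 k) =
     (same_colour k x)%:R *: bx x).
Proof.
pose rho : {lrmorphism YH q0 d N.+1 -> 'M[K]_M.+1} :=
  quot_lift (S1 := @YH_proper K q q0 d N.+1) gens_rel.
have rho_g k : rho (@Y_g K q q0 d N.+1 k) = G k.
  by rewrite [LHS]quot_liftE free_evalE.
have rho_t j : rho (@Y_t K q q0 d N.+1 j) = T j.
  by rewrite [LHS]quot_liftE free_evalE.
exists rho; split=> k x; first by rewrite rho_g bxG.
by rewrite /Y_e rmorph_tie_elt !rho_t bx_tie.
Qed.

End Representation.

(** * The algebra of braids and ties *)

(** [X^d - 1] is separable because [d] is invertible, so it has [d] distinct roots, and a group of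
    [d] roots of unity contains a primitive one. *)
Lemma closed_prim_root (F : closedFieldType) (d : nat) : d%:R != 0 :> F ->
  exists z : F, d.-primitive_root z.
Proof.
move=> d0; have d_gt0 : (0 < d)%N by case: d d0; rewrite ?eqxx.
have [rs rsE] := closed_field_poly_normal ('X^d - 1 : {poly F}).
rewrite (monicP _) ?monicXnsubC // scale1r in rsE.
have rs_root : all d.-unity_root rs.
  by apply/allP => z; rewrite -root_prod_XsubC -rsE.
have sz_rs : (size rs).+1 = d.+1 by rewrite -(size_prod_XsubC rs id) -rsE size_XnsubC.
have rs_uniq : uniq rs by rewrite -separable_prod_XsubC -rsE separable_Xn_sub_1.
have /hasP[z _ zprim] := has_prim_root d_gt0 rs_root rs_uniq (eq_leq (esym sz_rs)).
by exists z.
Qed.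

Lemma Cq_prim_root (R : realType) (d : nat) : (0 < d)%N ->
  exists z : Cq R, d.-primitive_root z.
Proof.
move=> d_gt0; have [|z zprim] := @closed_prim_root R[i] d.
  by rewrite pnatr_eq0 -lt0n.
exists (tofrac z%:P).
pose f : {rmorphism R[i] -> Cq R} := @tofrac {poly R[i]} \o polyC.
by rewrite -[tofrac _]/(f z) fmorph_primitive_root.
Qed.

(** Evaluation into the generated subalgebra followed by inclusion fixes the generators, hence is
    the identity by uniqueness. *)
Lemma free_alg_generated (K : fieldType) (I : choiceType) (x : free_alg K I) :
  subalg_gen (range (@free_gen K I)) x.
Proof.
pose S := range (@free_gen K I).
have Sgen i : @free_gen K I i \in in_subalg_gen S.
  by apply/in_subalg_genP; apply: sub_gen_smallest; exists i.
pose f : {lrmorphism free_alg K I -> subalg S} := free_eval (fun i => Subalg (Sgen i)).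
pose vf : {lrmorphism free_alg K I -> free_alg K I} := @subalg_val _ _ S \o f.
have -> : x = vf x.
  apply/esym; apply: (free_eval_uniq (f1 := vf) (f2 := idfun)) => i /=.
  by rewrite free_evalE.
by apply/in_subalg_genP; exact: (valP (f x)).
Qed.

Section BraidsAndTiesFamily.
Variables (K : fieldType) (q : K) (q0 : q != 0) (N : nat).
Local Notation A := (BT q0 N.+1).
Local Notation pi := (quot_pi (@BT_proper K q q0 N.+1)).
Local Notation gen := (@free_gen K (BT_gen N.+1)).

Definition BT_b_nat i : A := if insub i is Some k then @BT_b K q q0 N.+1 k else 1.
Definition BT_eps_nat i : A := if insub i is Some k then @BT_eps K q q0 N.+1 k else 0.

Lemma BT_b_natE (k : 'I_N) : BT_b_nat k = @BT_b K q q0 N.+1 k.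
Proof. by rewrite /BT_b_nat valK. Qed.

Lemma BT_eps_natE (k : 'I_N) : BT_eps_nat k = @BT_eps K q q0 N.+1 k.
Proof. by rewrite /BT_eps_nat valK. Qed.

Lemma BT_relP l r : BT_rel q l r -> pi l = pi r.
Proof.
by move=> lr; apply/quot_pi_eq; apply: sub_gen_smallest; exists l, r.
Qed.

Variant nat_gen_spec : nat -> A -> A -> Prop :=
| NatGenIn (k : 'I_N) :
    nat_gen_spec k (@BT_b K q q0 N.+1 k) (@BT_eps K q q0 N.+1 k)
| NatGenOut i of (N <= i)%N : nat_gen_spec i 1 0.

Lemma nat_genP i : nat_gen_spec i (BT_b_nat i) (BT_eps_nat i).
Proof.
rewrite /BT_b_nat /BT_eps_nat; case: insubP => [k _ <-|iN]; constructor.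
by rewrite leqNgt.
Qed.

Lemma BT_braid_ties : braid_ties (q - q^-1) N BT_b_nat BT_eps_nat.
Proof.
have inN i : (i < N)%N -> exists k : 'I_N, i = k by move=> iN; exists (Ordinal iN).
split=> [i iN|i j|i j|i|i|i j|i j|i j|i j|i].
- have [k iE] := inN _ (ltnW iN); have [l lE] := inN _ iN.
  rewrite lE iE !BT_b_natE -!rmorphM; apply: BT_relP; constructor.
  by rewrite -lE iE.
- case: (nat_genP i) => {i} [k|i _]; last by rewrite mul1r mulr1.
  case: (nat_genP j) => {j} [l|j _]; last by rewrite mul1r mulr1.
  move=> kl; rewrite -!rmorphM; apply: BT_relP; constructor.
  by rewrite /distant kl.
- case: (nat_genP i) => {i} [k|i _]; last by rewrite mul0r mulr0.
  case: (nat_genP j) => {j} [l|j _]; last by rewrite mul0r mulr0.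
  move=> kl; rewrite -!rmorphM; apply: BT_relP; constructor.
  by rewrite /distant kl.
- case: (nat_genP i) => {i} [k|i _]; last by rewrite mul0r.
  by rewrite -rmorphM -expr2; apply: BT_relP; constructor.
- case: (nat_genP i) => {i} [k|i _]; last by rewrite mul0r mulr0.
  by rewrite -!rmorphM; apply: BT_relP; constructor.
- case: (nat_genP i) => {i} [k|i _]; last by rewrite mul0r mulr0.
  case: (nat_genP j) => {j} [l|j _]; last by rewrite mul1r mulr1.
  by move=> kl; rewrite -!rmorphM; apply: BT_relP; constructor.
- move=> /inN[k ->] /inN[l ->] kl; rewrite !BT_b_natE !BT_eps_natE -!rmorphM.
  by apply: BT_relP; constructor.
- move=> /inN[k ->] /inN[l ->] kl; rewrite !BT_b_natE !BT_eps_natE -!rmorphM.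
  by apply: BT_relP; constructor.
- move=> /inN[k ->] /inN[l ->] kl; rewrite !BT_b_natE !BT_eps_natE -!rmorphM.
  by apply: BT_relP; constructor.
- case: (nat_genP i) => {i} [k|i _]; last by rewrite mul0r scaler0 addr0 mulr1.
  rewrite -expr2 -rmorphXn -rmorphM -linearZ -(rmorph1 pi) -rmorphD.
  by apply: BT_relP; constructor.
Qed.

Lemma BT_generated (x : A) :
  subalg_gen [set u | exists i, (i < N)%N /\ (u = BT_b_nat i \/ u = BT_eps_nat i)] x.
Proof.
have [y ->] := quot_pi_surj x; set S := (S in subalg_gen S _).
have := free_alg_generated y; apply: (smallest_sub (X := [set y | subalg_gen S (pi y)])).
  have [S1 SD SM] := subalg_gen_closed S.
  split=> [|a u w|u w]; rewrite ?inE /=.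
  - by rewrite rmorph1; apply/in_subalg_genP.
  - move=> /in_subalg_genP Su /in_subalg_genP Sw; apply/in_subalg_genP.
    by rewrite linearP; apply: SD.
  - move=> /in_subalg_genP Su /in_subalg_genP Sw; apply/in_subalg_genP.
    by rewrite rmorphM; apply: SM.
move=> _ [[k|k] _ <-]; apply: sub_gen_smallest; exists (nat_of_ord k); split=> //.
  by left; rewrite BT_b_natE.
by right; rewrite BT_eps_natE.
Qed.

End BraidsAndTiesFamily.

(** * The isomorphism *)

Lemma inj_surj_bijective (T U : Type) (f : T -> U) :
  injective f -> (forall y, exists x, y = f x) -> bijective f.
Proof.
move=> f_inj f_surj; pose g y := sval (cid (f_surj y)).
have fgK y : f (g y) = y by rewrite /g; case: cid.
by exists g => // x; apply: f_inj; rewrite fgK.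
Qed.

(** * Isomorphisms between quotient algebras *)

Section QuotientIso.
Variables (K : fieldType) (A B : algType K) (S : set A) (S' : set B).
Variables (S1 : ~ ideal_gen S 1) (S'1 : ~ ideal_gen S' 1).
Variable phi : {lrmorphism A -> B}.
Hypothesis phi_inj : injective phi.
Hypothesis phi_surj : forall y, exists x, y = phi x.
Hypothesis phiS : forall x, S x -> ideal_gen S' (phi x).
Hypothesis phiS' : forall x, S' (phi x) -> ideal_gen S x.

Lemma quot_iso : exists f : {lrmorphism alg_quot S1 -> alg_quot S'1}, bijective f.
Proof.
pose g : {lrmorphism A -> alg_quot S'1} := quot_pi S'1 \o phi.
have gS x : S x -> g x = 0.
  move=> Sx; rewrite -(rmorph0 (quot_pi S'1)); apply/quot_pi_eq.
  by rewrite subr0; apply: phiS.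
pose f : {lrmorphism alg_quot S1 -> alg_quot S'1} := quot_lift (S1 := S1) gS.
have fE x : f (quot_pi S1 x) = quot_pi S'1 (phi x) by rewrite [LHS]quot_liftE.
(* By minimality: the elements of [B] whose preimages all lie in the ideal of [S] form an ideal
   containing [S']. *)
have phi_ideal y : ideal_gen S' y -> forall x, y = phi x -> ideal_gen S x.
  move=> idy; apply: (idy [set y | forall x, y = phi x -> ideal_gen S x]%classic).
  split; last by move=> z Sz x zx; apply: phiS'; rewrite -zx.
  split=> /= [x|u w iu iw x|a u iu x|a u iu x].
  - by rewrite -(rmorph0 phi) => /phi_inj <-; apply: ideal_gen0.
  - have [u' uE] := phi_surj u; have [w' wE] := phi_surj w.
    rewrite uE wE -rmorphD => /phi_inj <-.
    by apply: ideal_genD; [apply: (iu _ uE)|apply: (iw _ wE)].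
  - have [u' uE] := phi_surj u; have [a' aE] := phi_surj a.
    by rewrite uE aE -rmorphM => /phi_inj <-; apply: ideal_genMl; apply: (iu _ uE).
  - have [u' uE] := phi_surj u; have [a' aE] := phi_surj a.
    by rewrite uE aE -rmorphM => /phi_inj <-; apply: ideal_genMr; apply: (iu _ uE).
exists f; apply: inj_surj_bijective => [u w|y].
  have [x ->] := quot_pi_surj u; have [x' ->] := quot_pi_surj w.
  rewrite !fE => /quot_pi_eq idx; apply/quot_pi_eq.
  by apply: phi_ideal idx _ _; rewrite rmorphB.
have [z ->] := quot_pi_surj y; have [x ->] := phi_surj z.
by exists (quot_pi S1 x); rewrite fE.
Qed.

End QuotientIso.

(** * Conjugacy of the tied Steinberg elements *)

Section SteinbergShift.
Variables (K : fieldType) (A : algType K) (c q : K) (N : nat) (b e : nat -> A).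
Hypothesis bt : braid_ties c N b e.

Definition tied_steinberg i := e i * e i.+1 * steinberg_elt q (b i) (b i.+1).

Lemma steinberg_elt_intertwine (w x y x' y' : A) : w * x = x' * w -> w * y = y' * w ->
  w * steinberg_elt q x y = steinberg_elt q x' y' * w.
Proof.
move=> wx wy; have comm2 u u' v v' : w * u = u' * w -> w * v = v' * w ->
    w * (u * v) = u' * v' * w.
  by move=> wu wv; rewrite mulrA wu -mulrA wv mulrA.
have wxy := comm2 _ _ _ _ wx wy; have wyx := comm2 _ _ _ _ wy wx.
have wxyx := comm2 _ _ _ _ wxy wx.
rewrite /steinberg_elt !(mulrDr w) mulr1 -!scalerAr !(mulrDr w) wxyx wxy wyx wx wy.
by rewrite !(mulrDl _ _ w) -!scalerAl !(mulrDl _ _ w) mul1r.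
Qed.

Lemma tied_steinberg_shift i : (i.+2 < N)%N ->
  exists w w', w * w' = 1 /\ tied_steinberg i.+1 = w * tied_steinberg i * w'.
Proof.
move=> iN; pose w := b i * b i.+1 * b i.+2.
have [w' ww'] : exists w', w * w' = 1.
  exists ((b i.+2 - c *: e i.+2) * ((b i.+1 - c *: e i.+1) * (b i - c *: e i))).
  by rewrite /w mulrA -(mulrA _ (b i.+2)) (b_binv bt) mulr1 mulrA -(mulrA _ (b i.+1))
    (b_binv bt) mulr1 (b_binv bt).
have far : b i.+2 * b i = b i * b i.+2 by apply/esym/(bt_comm bt).
have wb : w * b i = b i.+1 * w.
  by rewrite /w -mulrA far !mulrA (bt_braid bt) //; lia.
have wb1 : w * b i.+1 = b i.+2 * w.
  by rewrite /w -!mulrA (mulrA (b i.+1)) (bt_braid bt) // !mulrA far.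
have we : w * e i = e i.+1 * w.
  rewrite /w -mulrA -(bt_eps_b_comm bt); last by lia.
  by rewrite !mulrA -(bt_slide bt) //; lia.
have we1 : w * e i.+1 = e i.+2 * w.
  rewrite /w -!mulrA (mulrA (b i.+1)) -(bt_slide bt) ?mulrA //; try lia.
  by rewrite (bt_eps_b_comm bt) //; lia.
clearbody w; exists w, w'; split=> //.
rewrite /tied_steinberg !mulrA we -(mulrA _ w) we1 mulrA -(mulrA _ w).
by rewrite (steinberg_elt_intertwine wb wb1) !mulrA -(mulrA _ w w') ww' mulr1.
Qed.

End SteinbergShift.

(** * Braids and ties inside the Yokonuma-Hecke algebra *)

Section Embedding.
Variables (K : fieldType) (q : K) (q0 : q != 0) (q2 : q - q^-1 != 0) (d N : nat).
Hypotheses (d0 : d%:R != 0 :> K) (N_d : (N < d)%N).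
Variables (z : K) (zprim : d.-primitive_root z).
Local Notation A := (BT q0 N.+1).
Local Notation Y := (Ybr q0 d N.+1).
Local Notation g := (@Y_g K q q0 d N.+1).
Local Notation ye := (@Y_e K q q0 d N.+1).

Definition br_g (k : 'I_N) : Y := Subalg (@Y_g_in_Ybr K q q0 d N.+1 k).
Definition br_e (k : 'I_N) : Y := Subalg (@Y_e_in_Ybr K q q0 d N.+1 d0 q2 k).

Let gens (u : BT_gen N.+1) : Y := match u with inl k => br_g k | inr k => br_e k end.

Let sval_inj (x y : Y) : subalg_val x = subalg_val y -> x = y.
Proof. exact: val_inj. Qed.

Let gens_rel u : relators (BT_rel q (n := N.+1)) u -> free_eval gens u = 0.
Proof.
move=> [l [r [lr ->]]]; rewrite rmorphB /=; apply/eqP; rewrite subr_eq0; apply/eqP.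
case: lr => [i j ij|i j ij|i j ij|i|i|i j ij|i j ij|i j ij|i j ij|i].
- rewrite !rmorphM /= !free_evalE; apply: sval_inj.
  by apply: Y_braid; rewrite /adjacent ij eqxx.
- by rewrite !rmorphM /= !free_evalE; apply: sval_inj; apply: Y_comm.
- by rewrite !rmorphM /= !free_evalE; apply: sval_inj; apply: Y_e_comm.
- by rewrite rmorphXn /= !free_evalE; apply: sval_inj; apply: Y_e_idem.
- by rewrite !rmorphM /= !free_evalE; apply: sval_inj; apply: Y_e_g.
- by rewrite !rmorphM /= !free_evalE; apply: sval_inj; apply: Y_e_g_comm.
- by rewrite !rmorphM /= !free_evalE; apply: sval_inj; apply: Y_tie1.
- by rewrite !rmorphM /= !free_evalE; apply: sval_inj; apply: Y_tie2.
- by rewrite !rmorphM /= !free_evalE; apply: sval_inj; apply: Y_slide.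
- rewrite rmorphXn rmorphD /= rmorph1 linearZ /= rmorphM /= !free_evalE.
  by apply: sval_inj; apply: Y_quadratic.
Qed.

Definition BT_to_Ybr : {lrmorphism A -> Y} :=
  quot_lift (S1 := @BT_proper K q q0 N.+1) gens_rel.

Lemma BT_to_Ybr_b k : BT_to_Ybr (@BT_b K q q0 N.+1 k) = br_g k.
Proof. by rewrite [LHS]quot_liftE free_evalE. Qed.

Lemma BT_to_Ybr_eps k : BT_to_Ybr (@BT_eps K q q0 N.+1 k) = br_e k.
Proof. by rewrite [LHS]quot_liftE free_evalE. Qed.

Lemma BT_to_Ybr_surj y : exists x, y = BT_to_Ybr x.
Proof.
have /in_subalg_genP ygen : subalg_val y \in in_subalg_gen (range g) := valP y.
suff [x yx] : exists x, subalg_val y = subalg_val (BT_to_Ybr x).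
  by exists x; apply: sval_inj.
apply: (ygen [set u | exists x, u = subalg_val (BT_to_Ybr x)]%classic); split.
  split=> [|a u w|u w]; rewrite ?inE /=.
  - by exists 1; rewrite rmorph1.
  - by move=> [x ->] [x' ->]; exists (a *: x + x'); rewrite !linearP.
  - by move=> [x ->] [x' ->]; exists (x * x'); rewrite !rmorphM.
by move=> _ [k _ <-]; exists (@BT_b K q q0 N.+1 k); rewrite BT_to_Ybr_b.
Qed.

Lemma BT_to_Ybr_inj : injective BT_to_Ybr.
Proof.
apply: raddf_inj => x phix.
(* Any colouring will do; it shows that the basis of the representation is nonempty. *)
have al0 : {ffun 'I_N.+1 -> 'I_d}.
  by apply: [ffun => Ordinal (leq_ltn_trans (leq0n N) N_d)].
have [enc [dec [encK decK]]] := fin_coding ((al0, 1%g) : cperm d N).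
have [r [r_g r_e]] := YH_rep q0 encK decK zprim d0.
(* As [rho] factors through [BT_to_Ybr], it kills [x], while it is faithful on the last layer. *)
pose rho : {lrmorphism A -> 'M[K]_(#|cperm d N|.-1.+1)} :=
  r \o @subalg_val K (YH q0 d N.+1) (range g) \o BT_to_Ybr.
apply: (layer_faithful (rho := rho) (BT_braid_ties q0 N) N_d encK decK _ _ (leqnn N)).
- by move=> k u; rewrite BT_b_natE /rho /= BT_to_Ybr_b r_g.
- by move=> k u; rewrite BT_eps_natE /rho /= BT_to_Ybr_eps r_e.
- exact: (layer_full (BT_braid_ties q0 N) (BT_generated x)).
- by move=> al; rewrite /rho /= phix !rmorph0 mulmx0.
Qed.

Let tied i := tied_steinberg q (@BT_b_nat K q q0 N) (@BT_eps_nat K q q0 N) i.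

Let tiedE (k l : 'I_N) : l = k.+1 :> nat ->
  @BT_eps K q q0 N.+1 k * @BT_eps K q q0 N.+1 l *
    steinberg_elt q (@BT_b K q q0 N.+1 k) (@BT_b K q q0 N.+1 l) = tied k.
Proof.
by move=> lk; rewrite -!BT_b_natE -!BT_eps_natE lk.
Qed.

Let BT_to_Ybr_tied (k l : 'I_N) :
  subalg_val (BT_to_Ybr (@BT_eps K q q0 N.+1 k * @BT_eps K q q0 N.+1 l *
    steinberg_elt q (@BT_b K q q0 N.+1 k) (@BT_b K q q0 N.+1 l))) =
  ye k * ye l * steinberg_elt q (g k) (g l).
Proof.
by rewrite !rmorphM /= !rmorph_steinberg_elt !BT_to_Ybr_b !BT_to_Ybr_eps.
Qed.

(** Conjugating one index down at a time leads to index 0, whose image is the generator of the other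
    ideal. *)
Lemma BT_to_Ybr_PTL_elt u : PTL_elt u ->
  ideal_gen (@FTL_elt K q q0 d N.+1) (BT_to_Ybr u).
Proof.
move=> [k [l [lk ->]]]; rewrite tiedE //.
have : (k.+1 < N)%N by rewrite -lk.
elim: (nat_of_ord k) => {k l lk} [|i IHi] iN.
  have N_gt0 := ltnW iN; rewrite -(@tiedE (Ordinal N_gt0) (Ordinal iN)) //.
  apply: sub_gen_smallest; exists (Ordinal N_gt0), (Ordinal iN).
  by split=> //; rewrite BT_to_Ybr_tied.
have [w [w' [_ wE]]] := tied_steinberg_shift q (BT_braid_ties q0 N) iN.
rewrite /tied wE 2!rmorphM; apply: ideal_genMr; apply: ideal_genMl.
by apply: IHi; apply: ltnW.
Qed.

Lemma BT_to_Ybr_FTL_elt u : FTL_elt (BT_to_Ybr u) ->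
  ideal_gen (@PTL_elt K q q0 N.+1) u.
Proof.
move=> [k [l [k0 l1 uE]]]; apply: sub_gen_smallest; exists k, l.
split; first by rewrite k0.
by apply: BT_to_Ybr_inj; apply: sval_inj; rewrite BT_to_Ybr_tied.
Qed.

Lemma PTL_iso_FTLbr :
  exists f : {lrmorphism PTL q0 N.+1 -> FTLbr q0 d N.+1}, bijective f.
Proof.
exact: quot_iso BT_to_Ybr_inj BT_to_Ybr_surj BT_to_Ybr_PTL_elt BT_to_Ybr_FTL_elt.
Qed.

End Embedding.

Theorem proposition5 (R : realType) (d n : nat)
    (hn : (3 <= n)%N) (hd : (n <= d)%N) :
  exists f : {lrmorphism PTL (qvar_neq0 R) n -> FTLbr (qvar_neq0 R) d n},
    bijective f.
Proof.
case: n hn hd => // N _ N_d; have d_gt0 : (0 < d)%N by apply: leq_trans N_d.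
have [z zprim] := Cq_prim_root R d_gt0.
apply: (PTL_iso_FTLbr _ (qvarBV_neq0 R) _ N_d zprim).
by rewrite Cq_nat_eq0 -lt0n.
Qed.
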